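(* Let $n\wedge p\wedge q\to\infty$. Suppose that there are constants $a,b,a',b'$ not depending on $p,q$ with $0<a\le\inf_i \mathrm{var}(x_i)\le\sup_iE(x_i^2)\le b<\infty$ and $0<a'\le\inf_j \mathrm{var}(y_j)\le\sup_jE(y_j^2)\le b'<\infty$. (i) One has $$\tau\times hCov_n^2(\mathbf X,\mathbf Y)=f^{(1)}\!\left(\frac{\tau_X}{\gamma_{\mathbf X}}\right)g^{(1)}\!\left(\frac{\tau_Y}{\gamma_{\mathbf Y}}\right)\frac{\tau_X}{\gamma_{\mathbf X}}\frac{\tau_Y}{\gamma_{\mathbf Y}}\,\frac1\tau\sum_{i=1}^p\sum_{j=1}^q\mathrm{cov}_n^2(\mathcal X_i,\mathcal Y_j)+\mathcal R_n,$$ where $\mathcal R_n$ is the remainder term. (ii) Denote $E[L_X(X,X')^2]=\alpha_p^2$, $E[L_Y(Y,Y')^2]=\beta_q^2$, $E[L_X(X,X')^4]=\gamma_p^2$, $E[L_Y(Y,Y')^4]=\lambda_q^2$ (with $\alpha_p,\beta_q,\gamma_p,\lambda_q\ge0$; the numbers $\gamma_p$ are unrelated to the bandwidths $\gamma_{\mathbf X},\gamma_{\mathbf Y}$), and suppose further that, as $n\wedge p\wedge q\to\infty$: $n\alpha_p=o(1)$, $n\beta_q=o(1)$, $\tau_X^2(\alpha_p\gamma_p+\gamma_p^2)=o(1)$, $\tau_Y^2(\beta_q\lambda_q+\lambda_q^2)=o(1)$, $\tau(\alpha_p\lambda_q+\gamma_p\beta_q+\gamma_p\lambda_q)=o(1)$.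 Then $$f^{(1)}\!\left(\frac{\tau_X}{\gamma_{\mathbf X}}\right)g^{(1)}\!\left(\frac{\tau_Y}{\gamma_{\mathbf Y}}\right)\frac{\tau_X}{\gamma_{\mathbf X}}\frac{\tau_Y}{\gamma_{\mathbf Y}}\asymp_p1,\qquad\frac1\tau\sum_{i=1}^p\sum_{j=1}^q\mathrm{cov}_n^2(\mathcal X_i,\mathcal Y_j)=O_p(\tau\alpha_p\beta_q),$$ $$\mathcal R_n=O_p(\tau\alpha_p\lambda_q+\tau\gamma_p\beta_q+\tau\gamma_p\lambda_q)=o_p(1).$$
   Context: Setting (high dimension, medium sample size: $p\wedge q\to\infty$ and $n\to\infty$ at a slower rate than $p,q$). For each $p,q$, $(X,Y)$ is a pair of random vectors $X=(x_1,\dots,x_p)^T\in\mathbb R^p$, $Y=(y_1,\dots,y_q)^T\in\mathbb R^q$. $(X_1,Y_1),\dots,(X_n,Y_n)$ are i.i.d. copies of $(X,Y)$, with $X_s=(x_{s1},\dots,x_{sp})^T$, $Y_s=(y_{s1},\dots,y_{sq})^T$; $\mathbf X=(X_1,\dots,X_n)^T$, $\mathbf Y=(Y_1,\dots,Y_n)^T$; $\mathcal X_i=(x_{1i},\dots,x_{ni})^T$, $\mathcal Y_j=(y_{1j},\dots,y_{nj})^T$. $|\cdot|$ is the Euclidean norm; $(X',Y')$ is an independent copy of $(X,Y)$. $Z_s\asymp_pa_s$ means $Z_s/a_s=O_p(1)$ and $a_s/Z_s=O_p(1)$. $\mathcal U$-centering. For any matrix $\mathbf A=(a_{st})\in\mathbb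 R^{n\times n}$, $\widetilde{\mathbf A}=(\tilde a_{st})$ has $\tilde a_{ss}=0$ and, for $s\neq t$, $\tilde a_{st}=a_{st}-\frac1{n-2}\sum_{v=1}^na_{sv}-\frac1{n-2}\sum_{u=1}^na_{ut}+\frac1{(n-1)(n-2)}\sum_{u,v=1}^na_{uv}$; $(\widetilde{\mathbf A}\cdot\widetilde{\mathbf B})=\frac1{n(n-3)}\sum_{s\ne t}\tilde a_{st}\tilde b_{st}$. Kernels: the kernels considered are those of the form $K(x,y)=f(|x-y|/\gamma)$ and $L(x,y)=g(|x-y|/\gamma)$, with $\gamma$ a bandwidth parameter, for some continuously differentiable functions $f,g$ with derivatives $f^{(1)},g^{(1)}$; examples are the Gaussian kernel, $f(a)=\exp(-a^2/2)$, and the Laplacian kernel, $f(a)=\exp(-a)$. Sample Hilbert–Schmidt covariance: $hCov_n^2(\mathbf X,\mathbf Y)=(\widetilde{\mathbf R}\cdot\widetilde{\mathbf H})$, where $\mathbf R=(r_{st})_{s,t=1}^n$, $\mathbf H=(h_{st})_{s,t=1}^n$, $r_{st}=f(|X_s-X_t|/\gamma_{\mathbf X})$, $h_{st}=g(|Y_s-Y_t|/\gamma_{\mathbf Y})$, with $\gamma_{\mathbf X}=\mathrm{median}\{|X_s-X_t|:s\ne t\}$, $\gamma_{\mathbf Y}=\mathrm{median}\{|Y_s-Y_t|:s\ne t\}$. $\mathrm{cov}_n^2(\mathcal X_i,\mathcal Y_j)=\binom n4^{-1}\sum_{s<t<u<v}\frac1{4!}\sum_*\frac14(x_{si}-x_{ti})(y_{sj}-y_{tj})(x_{ui}-x_{vi})(y_{uj}-y_{vj})$,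 where $\sum_*$ is over all permutations of the 4-tuple of indices $(s,t,u,v)$. Notation: $\tau_X^2=E|X-X'|^2$, $\tau_Y^2=E|Y-Y'|^2$, $\tau=\tau_X\tau_Y$ (positive roots); $L_X(X,X')=\frac{|X-X'|^2-\tau_X^2}{\tau_X^2}$, $L_Y(Y,Y')=\frac{|Y-Y'|^2-\tau_Y^2}{\tau_Y^2}$.
   Formalization: R and H are taken with zero diagonal (with f(0), g(0) there R_n=o_p(1) fails); f^(1)(1), g^(1)(1) nonzero is assumed for the claim ''asymp_p 1''; f^(1), g^(1) Lipschitz near 1 is assumed for the R_n bounds, which fail for merely C^1 kernels. *)

(* Defs.v *)
From HB Require Import structures.
From mathcomp Require Export all_boot all_order all_fingroup all_algebra.
From mathcomp Require Export all_classical all_reals all_analysis.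
Export Order.TTheory GRing.Theory Num.Theory.
Export numFieldNormedType.Exports.

Set Implicit Arguments.
Unset Strict Implicit.
Unset Printing Implicit Defensive.

Local Open Scope classical_set_scope.
Local Open Scope ring_scope.

(* Random vectors in R^p are random elements of the measurable type
   [p.-tuple R], whose sigma-algebra is generated by the coordinates. *)

Section Laws.
Context {d d' : measure_display} {T : measurableType d} {S : measurableType d'}
  {R : realType} (P : probability T R).

Definition same_law (Z Z' : T -> S) : Prop :=
  forall A, measurable A -> P (Z @^-1` A) = P (Z' @^-1` A).

Definition independent2 (Z Z' : T -> S) : Prop :=
  forall A B, measurable A -> measurable B ->
    P (Z @^-1` A `&` Z' @^-1` B) = (P (Z @^-1` A) * P (Z' @^-1` B))%E.

(* The product rule for subfamilies is obtained by taking B s = setT outside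
   of the subfamily. *)
Definition mutually_independent n (Z : 'I_n -> T -> S) : Prop :=
  forall B : 'I_n -> set S, (forall s, measurable (B s)) ->
    P (\bigcap_(s in [set: 'I_n]) Z s @^-1` B s)
    = (\prod_(s < n) P (Z s @^-1` B s))%E.

Definition iid_copies n (Z : 'I_n -> T -> S) (Z0 : T -> S) : Prop :=
  (forall s, same_law (Z s) Z0) /\ mutually_independent Z.

Definition independent_copy (Z' Z : T -> S) : Prop :=
  same_law Z' Z /\ independent2 Z Z'.

End Laws.

Definition joint {T A B : Type} (X : T -> A) (Y : T -> B) : T -> A * B :=
  fun w => (X w, Y w).

Section Stochastic_orders.
Context {R : realType} {d : nat -> measure_display}
  {Omega : forall k, measurableType (d k)} (P : forall k, probability (Omega k) R).
Implicit Types Z W : forall k, Omega k -> R.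

(* Z_k / W_k = O_p(1), written without division: where W_k vanishes and Z_k
   does not, the ratio counts as infinite. *)
Definition bigOp Z W : Prop :=
  forall e : R, 0 < e -> exists2 M : R, 0 < M &
    \forall k \near \oo,
      (P k [set w | (M * `|W k w| < `|Z k w|)%R] <= e%:E)%E.

Definition littleop Z W : Prop :=
  forall c : R, 0 < c ->
    P k [set w | (c * `|W k w| < `|Z k w|)%R] @[k --> \oo] --> 0%E.

Definition asymp_p Z W : Prop := bigOp Z W /\ bigOp W Z.

End Stochastic_orders.

Section Population.
Context {R : realType}.

Definition edist p (x y : p.-tuple R) : R :=
  Num.sqrt (\sum_(i < p) (tnth x i - tnth y i) ^+ 2).

(* The positive square root of E|X - X'|^2. *)
Definition tau {d} {T : measurableType d} (P : probability T R) p
    (X X' : T -> p.-tuple R) : R :=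
  Num.sqrt (fine 'E_P[fun w => edist (X w) (X' w) ^+ 2]).

Definition Ldev (t : R) p (x x' : p.-tuple R) : R :=
  (edist x x' ^+ 2 - t ^+ 2) / t ^+ 2.

End Population.

Section Sample.
Context {R : realType}.

(* Usual sample median: the mean of the two middle order statistics when the
   size is even (the two indices coincide when it is odd). *)
Definition median (s : seq R) : R :=
  let t := sort <=%R s in
  (nth 0 t (size t).-1./2 + nth 0 t (size t)./2) / 2.

Definition bandwidth n p (xs : 'I_n -> p.-tuple R) : R :=
  median [seq edist (xs st.1) (xs st.2)
         | st in [pred st : 'I_n * 'I_n | st.1 != st.2]].

(* The diagonal is set to 0. U-centering annihilates constants added to the
   off-diagonal entries only under this convention: the diagonal entry f 0
   would contribute - f 0 / (n - 1) to every off-diagonal entry of the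
   U-centered matrix. *)
Definition kernel_mx (f : R -> R) n p (xs : 'I_n -> p.-tuple R) : 'M[R]_n :=
  \matrix_(s, t)
    if s == t then 0 else f (edist (xs s) (xs t) / bandwidth xs).

Definition Ucenter n (A : 'M[R]_n) : 'M[R]_n :=
  \matrix_(s, t)
    if s == t then 0 else
    A s t - (n%:R - 2)^-1 * (\sum_v A s v) - (n%:R - 2)^-1 * (\sum_u A u t)
    + ((n%:R - 1) * (n%:R - 2))^-1 * (\sum_u \sum_v A u v).

Definition Udot n (A B : 'M[R]_n) : R :=
  (n%:R * (n%:R - 3))^-1 * \sum_s \sum_(t | s != t) A s t * B s t.

Definition hCov2 (f g : R -> R) n p q
    (xs : 'I_n -> p.-tuple R) (ys : 'I_n -> q.-tuple R) : R :=
  Udot (Ucenter (kernel_mx f xs)) (Ucenter (kernel_mx g ys)).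

Definition cov_kernel n (x y : 'I_n -> R) (s t u v : 'I_n) : R :=
  4^-1 * ((x s - x t) * (y s - y t) * (x u - x v) * (y u - y v)).

Definition cov2 n (x y : 'I_n -> R) : R :=
  ('C(n, 4)%:R)^-1 *
  \sum_(i : 4.-tuple 'I_n | [&& (tnth i (inord 0) < tnth i (inord 1))%N,
                                (tnth i (inord 1) < tnth i (inord 2))%N &
                                (tnth i (inord 2) < tnth i (inord 3))%N])
    ((4`!)%:R)^-1 *
    \sum_(sg : 'S_4)
      cov_kernel x y (tnth i (sg (inord 0))) (tnth i (sg (inord 1)))
                     (tnth i (sg (inord 2))) (tnth i (sg (inord 3))).

Definition sum_cov2 n p q
    (xs : 'I_n -> p.-tuple R) (ys : 'I_n -> q.-tuple R) : R :=
  \sum_(i < p) \sum_(j < q)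
    cov2 (fun s => tnth (xs s) i) (fun s => tnth (ys s) j).

End Sample.

Section Kernels.
Context {R : realType}.

Definition C1_pos (f : R -> R) : Prop :=
  forall x : R, 0 < x -> derivable f x 1 /\ {for x, continuous (derive1 f : R -> R)}.

(* Satisfied in particular by every f that is C^2 on (0, +oo). *)
Definition lipschitz_near1 (h : R -> R) : Prop :=
  exists2 r : R, 0 < r & exists C : R,
    forall u v, `|u - 1| < r -> `|v - 1| < r -> `|h u - h v| <= C * `|u - v|.

End Kernels.

(* Main.v *)
From mathcomp Require Import ring lra zify measurable_realfun.
Require Import Defs.

Set Implicit Arguments.
Unset Strict Implicit.
Unset Printing Implicit Defensive.

(* Both hCov_n^2 and sum_{i,j} cov_n^2 are averages over injective quadruples
   (s,t,u,v) of D_A D_B, where D_A = A_su - A_sv - A_tu + A_tv: with weight 1/4 for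
   the kernel matrices and 1/16 for the matrices of squared distances. As D_A ignores
   constants, squared distances may be replaced by tau^2 L, and the Taylor expansion
   of the kernel at tau / gamma replaces the kernel matrix by (c / 2) L + O(L^2) with
   c = f'(tau / gamma) tau / gamma. Hence R_n is tau times an average of products
   L_X L_Y^2, L_X^2 L_Y and L_X^2 L_Y^2, and Cauchy-Schwarz over the quadruples bounds
   it by the sample means of L^2 and L^4, which Markov's inequality compares with
   their expectations. The expansion holds uniformly because the sum of L^2 over all
   pairs has expectation at most (n alpha)^2 = o(1): with high probability all
   distances, hence also their median gamma, are close to tau. *)

Local Open Scope ring_scope.

(** The bandwidth is computed from the same sample, so the coefficients [f (tau / gamma)] and c of
    the expansion are random and depend on all the distances. They are however common to all pairs
    (s, t): D_A annihilates the first, and the second factors out of the average, so the joint law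
    of bandwidth and distances never enters. This is why the expansion is made at tau / gamma and
    not at 1. What remains are deterministic inequalities on an event [G M] given by six Markov
    bounds (sum of L^2, mean of L^2 and mean of L^4, for X and for Y), each failing with probability
    at most 1 / M; O_p absorbs the constants that depend on M. The coefficient c / 2 appears because
    L measures squared distances: d / tau - 1 = L / 2 - (d / tau - 1)^2 / 2. The quadratic error
    comes from the Lipschitz derivative near 1 and the mean value theorem. *)

Section FourTuples.
Context {n : nat}.
Implicit Types j : 4.-tuple 'I_n.

Definition q0 j := tnth j (inord 0).
Definition q1 j := tnth j (inord 1).
Definition q2 j := tnth j (inord 2).
Definition q3 j := tnth j (inord 3).

Definition qsorted j : bool := [&& (q0 j < q1 j)%N, (q1 j < q2 j)%N & (q2 j < q3 j)%N].

Definition qperm j (s : 'S_4) : 4.-tuple 'I_n := [tuple tnth j (s i) | i < 4].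

Lemma tuple4E j : j = [tuple q0 j; q1 j; q2 j; q3 j].
Proof.
apply: eq_from_tnth => i; rewrite /q0 /q1 /q2 /q3.
case: i => -[|[|[|[|//]]]] Hi; rewrite (tnth_nth (q0 j)) [RHS](tnth_nth (q0 j)) /= (tnth_nth (q0 j)) inordK //.
Qed.

Lemma qpermK s : cancel (qperm^~ s) (qperm^~ s^-1%g).
Proof. by move=> j; apply: eq_from_tnth => i; rewrite !tnth_mktuple permKV. Qed.

Lemma qpermVK s : cancel (qperm^~ s^-1%g) (qperm^~ s).
Proof. by move=> j; apply: eq_from_tnth => i; rewrite !tnth_mktuple permK. Qed.

Lemma perm_qperm j s : perm_eq (qperm j s) j.
Proof. by rewrite perm_sym; apply/tuple_permP; exists (s^-1)%g; rewrite -{1}[j](qpermK s). Qed.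

Lemma qsortedE j : qsorted j = sorted (fun a b : 'I_n => (a < b)%N) j.
Proof. by rewrite [in RHS](tuple4E j) /= andbT. Qed.

(** A tuple without repetition is put in strictly increasing order by exactly one permutation:
    sorting gives one, and two strictly sorted arrangements of the same values coincide. A tuple
    with a repetition never becomes strictly sorted. The boolean [uniq j], read as 1 or 0, covers
    both cases. *)
Lemma card_qsorted j : #|[set s : 'S_4 | qsorted (qperm j s)]| = uniq j :> nat.
Proof.
have ltr : transitive (fun a b : 'I_n => (a < b)%N) by move=> ? ? ?; apply: ltn_trans.
have lti : irreflexive (fun a b : 'I_n => (a < b)%N) by move=> ?; apply: ltnn.
case: (boolP (uniq j)) => uj /=; last first.
  apply/eqP; rewrite cards_eq0 -finset.subset0; apply/fintype.subsetP => s; rewrite inE qsortedE => so.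
  by move: uj; rewrite -(perm_uniq (perm_qperm j s)) (sorted_uniq ltr lti so).
have [s0 sE] : exists s, sort (fun a b : 'I_n => (a <= b)%N) j = qperm j s.
  by apply/tuple_permP; rewrite perm_sort.
have s0P : qsorted (qperm j s0).
  rewrite qsortedE -sE.
  have := sort_sorted (fun a b : 'I_n => leq_total a b) j.
  have : uniq (sort (fun a b : 'I_n => (a <= b)%N) j) by rewrite sort_uniq.
  move: (sort _ _) => l ul sl.
  have -> : sorted (fun a b : 'I_n => (a < b)%N) l = sorted ltn (map val l).
    by rewrite sorted_map.
  rewrite ltn_sorted_uniq_leq map_inj_uniq ?ul //=; last exact: val_inj.
  by rewrite sorted_map.
suff -> : [set s : 'S_4 | qsorted (qperm j s)] = [set s0] by rewrite cards1.
apply/finset.setP => s; rewrite !inE; apply/idP/eqP => [sP|->//].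
have eqs : qperm j s = qperm j s0.
  apply: val_inj; apply: (irr_sorted_eq ltr lti); rewrite -?qsortedE //.
  by move=> x; rewrite (perm_mem (perm_qperm j s)) (perm_mem (perm_qperm j s0)).
apply/permP => i; have := congr1 (fun t => tnth t i) eqs; rewrite !tnth_mktuple => e.
by have /tuple_uniqP := uj; apply.
Qed.

(** After reindexing by the inverse permutation, F j is counted once for every s that sorts j, that
    is [uniq j] times. This turns the symmetrized sum in [cov2] into a sum over injective
    quadruples. *)
Lemma sum_sorted_perm (R : pzRingType) (F : 4.-tuple 'I_n -> R) :
  \sum_(j : 4.-tuple 'I_n | qsorted j) \sum_(s : 'S_4) F (qperm j s) = \sum_(j : 4.-tuple 'I_n | uniq j) F j.
Proof.
rewrite exchange_big /=.
under eq_bigr => s _.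
  rewrite (reindex_inj (can_inj (qpermVK s))) /=.
  under eq_bigr => j _ do rewrite qpermVK.
  rewrite big_mkcond /=.
  over.
rewrite (reindex_inj invg_inj) /=.
under eq_bigr => s _ do under eq_bigr => j _ do rewrite invgK.
rewrite exchange_big /= [RHS]big_mkcond /=; apply: eq_bigr => j _.
rewrite -big_mkcond /= sumr_const.
have -> : #|(fun s : 'S_4 => qsorted (qperm j s))| = uniq j :> nat.
  by rewrite -card_qsorted; apply: eq_card => s; rewrite inE.
by case: (uniq j).
Qed.

Lemma sum_uniq_nested (R : nmodType) (F : 'I_n -> 'I_n -> 'I_n -> 'I_n -> R) :
  \sum_(j : 4.-tuple 'I_n | uniq j) F (q0 j) (q1 j) (q2 j) (q3 j) =
  \sum_s \sum_(t | t != s) \sum_(u | (u != s) && (u != t))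
    \sum_(v | [&& v != s, v != t & v != u]) F s t u v.
Proof.
pose h (x : 'I_n * ('I_n * ('I_n * 'I_n))) : 4.-tuple 'I_n :=
  [tuple x.1; x.2.1; x.2.2.1; x.2.2.2].
have hE x : [/\ q0 (h x) = x.1, q1 (h x) = x.2.1, q2 (h x) = x.2.2.1 & q3 (h x) = x.2.2.2].
  by rewrite /q0 /q1 /q2 /q3; split; rewrite (tnth_nth x.1) /= inordK.
rewrite (reindex h) /=; last first.
  exists (fun j => (q0 j, (q1 j, (q2 j, q3 j)))) => [x _|j _]; last by rewrite [RHS]tuple4E.
  by have [-> -> -> ->] := hE x; case: x => ? [? []].
under eq_bigr => x _ do have [-> -> -> ->] := hE x.
under [RHS]eq_bigr => s _ do under eq_bigr => t _ do rewrite pair_big_dep /=.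
under [RHS]eq_bigr => s _ do rewrite pair_big_dep /=.
rewrite pair_big_dep /=; apply: eq_bigl => -[s [t [u v]]] /=.
rewrite !inE !negb_or andbT (eq_sym t s) (eq_sym u s) (eq_sym u t) (eq_sym v s) (eq_sym v t) (eq_sym v u).
by case: (s == t); case: (s == u); case: (s == v); case: (t == u); case: (t == v); case: (u == v).
Qed.

End FourTuples.

(** * Both statistics as averages over injective quadruples *)

Section QuadSum.
Context {R : comNzRingType} {n : nat}.

Lemma sumD2 (s t : 'I_n) (F : 'I_n -> R) : t != s ->
  \sum_(u | (u != s) && (u != t)) F u = \sum_u F u - F s - F t.
Proof. by move=> ts; rewrite [in RHS](bigD1 s) //= [in X in _ = X](bigD1 t) //=; ring. Qed.

(** Finite form of 2 cov(F, G) = E[(F - F') (G - G')]; the cardinality of S is written as a sum of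
    ones so as to live in the ring. *)
Lemma sum_sqdiff (S : pred 'I_n) (F G : 'I_n -> R) :
  \sum_(u | S u) \sum_(v | S v) (F u - F v) * (G u - G v) =
  2 * (\sum_(u | S u) 1) * (\sum_(u | S u) F u * G u)
  - 2 * (\sum_(u | S u) F u) * (\sum_(u | S u) G u).
Proof.
transitivity (\sum_(u | S u) \sum_(v | S v) (F u * G u * 1 + 1 * (F v * G v)
    - (F u * G v + G u * F v))).
  by apply: eq_bigr => u _; apply: eq_bigr => v _; ring.
under eq_bigr => u _ do rewrite sumrB !big_split /= -!mulr_sumr.
by rewrite sumrB !big_split /= -!mulr_suml; ring.
Qed.

(** The D_A of the overview, with s, t at positions 0, 1 and u, v at positions 2, 3. It annihilates
    every function of the form r s + c t. *)
Definition qdiff (A : 'I_n -> 'I_n -> R) (j : 4.-tuple 'I_n) : R :=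
  A (q0 j) (q2 j) - A (q0 j) (q3 j) - A (q1 j) (q2 j) + A (q1 j) (q3 j).

Lemma sum_qdiff (A B : 'I_n -> 'I_n -> R) :
  (forall s t, A s t = A t s) -> (forall s t, B s t = B t s) ->
  (forall s, A s s = 0) -> (forall s, B s s = 0) ->
  (forall s, \sum_t A s t = 0) -> (forall s, \sum_t B s t = 0) ->
  \sum_(j : 4.-tuple 'I_n | uniq j) qdiff A j * qdiff B j =
  4 * (n%:R - 1) * (n%:R - 2) * \sum_s \sum_t A s t * B s t.
Proof.
move=> symA symB A0 B0 rA rB; rewrite /qdiff.
(* For fixed s and t put F u = A s u - A t u and G u = B s u - B t u. The summand
   is (F u - F v) (G u - G v), which vanishes at v = u, and F and G have zero sum
   outside of {s, t}; so [sum_sqdiff] disposes of u and v. *)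
rewrite (sum_uniq_nested (fun s t u v => (A s u - A s v - A t u + A t v) *
   (B s u - B s v - B t u + B t v))).
(* There are n - 2 indices outside {s, t}, and leaving out u = s and u = t costs F s G s + F t G t =
   2 A_st B_st. *)
transitivity (\sum_s \sum_(t | t != s) (2 * (n%:R - 2)) *
    (\sum_u (A s u - A t u) * (B s u - B t u) - 2 * (A s t * B s t))).
  apply: eq_bigr => s _; apply: eq_bigr => t ts.
  transitivity (\sum_(u | (u != s) && (u != t)) \sum_(v | (v != s) && (v != t))
    ((A s u - A t u) - (A s v - A t v)) * ((B s u - B t u) - (B s v - B t v))).
    apply: eq_bigr => u us; rewrite [RHS](bigD1 u) //= subrr mul0r add0r.
    by apply: eq_big => [v|v _]; [rewrite andbA | ring].
  rewrite (sum_sqdiff (fun u => (u != s) && (u != t)) (fun u => A s u - A t u)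
    (fun u => B s u - B t u)) !sumD2 // sumrB !rA subrr.
  by rewrite sumr_const card_ord !A0 !B0 (symA t s) (symB t s); ring.
under eq_bigr => s _ do rewrite -mulr_sumr sumrB.
rewrite -mulr_sumr sumrB.
have diag (G : 'I_n -> 'I_n -> R) : (forall s, G s s = 0) ->
    \sum_s \sum_(t | t != s) G s t = \sum_s \sum_t G s t.
  by move=> G0; apply: eq_bigr => s _; rewrite [RHS](bigD1 s) //= G0 add0r.
rewrite (diag (fun s t => \sum_u (A s u - A t u) * (B s u - B t u))); last first.
  by move=> s; rewrite big1 // => u _; rewrite !subrr mul0r.
rewrite (diag (fun s t => 2 * (A s t * B s t))); last by move=> s; rewrite A0; ring.
set T1 := \sum_s \sum_t A s t * B s t.
have -> : \sum_s \sum_t 2 * (A s t * B s t) = 2 * T1.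
  by rewrite mulr_sumr; apply: eq_bigr => s _; rewrite mulr_sumr.
(* For fixed u the same covariance identity applies in s and t, now over all indices; the columns
   sum to zero by symmetry. In total 2 (n - 2) (2 n - 2) T1 = 4 (n - 1) (n - 2) T1. *)
have -> : \sum_s \sum_t \sum_u (A s u - A t u) * (B s u - B t u) = 2 * n%:R * T1.
  transitivity (\sum_u \sum_s \sum_t (A s u - A t u) * (B s u - B t u)).
    by under eq_bigr => s _ do rewrite exchange_big /=; rewrite exchange_big.
  transitivity (\sum_u 2 * n%:R * \sum_s A s u * B s u); last first.
    by rewrite -mulr_sumr exchange_big.
  apply: eq_bigr => u _.
  rewrite (sum_sqdiff predT (A^~ u) (B^~ u)) sumr_const card_ord.
  under [X in _ - 2 * X * _]eq_bigr => s _ do rewrite symA.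
  by rewrite rA; ring.
by ring.
Qed.

End QuadSum.

Section QuadMean.
Context {R : realType} {n : nat}.

(** [n ^_ 4] is the number of injective quadruples. For n < 4 the sum is empty and the inverse of 0
    is 0, so the value is 0. *)
Definition qmean (h : 4.-tuple 'I_n -> R) : R :=
  (n ^_ 4)%:R^-1 * \sum_(j : 4.-tuple 'I_n | uniq j) h j.

Lemma cov2E (x y : 'I_n -> R) :
  cov2 x y = qmean (fun j => cov_kernel x y (q0 j) (q1 j) (q2 j) (q3 j)).
Proof.
rewrite /cov2 /qmean -sum_sorted_perm -mulr_sumr mulrA -invfM -natrM bin_ffact.
by congr (_ * _); apply: eq_bigr => j _; apply: eq_bigr => s _;
  rewrite /q0 /q1 /q2 /q3 !tnth_mktuple.
Qed.

Lemma ffact4 : (n ^_ 4)%:R = n%:R * (n%:R - 1) * (n%:R - 2) * (n%:R - 3) :> R.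
Proof.
case: n => [|[|[|[|m]]]]; try by rewrite ffact_small //; ring.
by rewrite !ffactnS ffactn0 /= !natrM -!natr1; ring.
Qed.

Lemma qdiff_Ucenter (A : 'M[R]_n) (j : 4.-tuple 'I_n) :
  (forall s t, A s t = A t s) -> uniq j -> qdiff (Ucenter A) j = qdiff A j.
Proof.
move=> sA; rewrite [in uniq _](tuple4E j) /= !inE !negb_or !andbT.
move=> /and3P [/and3P [? /negPf n02 /negPf n03] /andP [/negPf n12 /negPf n13] _].
by rewrite /qdiff !mxE n02 n03 n12 n13; ring.
Qed.

(** With r the sum of row s and S the total, the row sum is r - (n - 1) r / (n - 2) - (S - r) / (n -
    2) + S / (n - 2) = 0. The zero diagonal makes r the sum over t != s. *)
Lemma sum_Ucenter (A : 'M[R]_n) s : (4 <= n)%N ->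
  (forall s t, A s t = A t s) -> (forall s, A s s = 0) -> \sum_t Ucenter A s t = 0.
Proof.
move=> n4 sA A0; rewrite (bigD1 s) //= mxE eqxx add0r.
transitivity (\sum_(t | t != s) (A s t - (n%:R - 2)^-1 * (\sum_v A s v)
   - (n%:R - 2)^-1 * (\sum_u A t u)
    + ((n%:R - 1) * (n%:R - 2))^-1 * (\sum_u \sum_v A u v))).
  apply: eq_bigr => t ts; rewrite mxE eq_sym (negPf ts); congr (_ - _ * _ + _).
  by apply: eq_bigr => u _; rewrite sA.
have H (F : 'I_n -> R) : \sum_(t | t != s) F t = \sum_t F t - F s.
  by rewrite [in RHS](bigD1 s) //=; ring.
rewrite H !big_split /= !sumrN !sumr_const card_ord -!mulr_sumr A0.
have : 4%:R <= n%:R :> R by rewrite ler_nat.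
rewrite -mulr_natl; move=> ?; field.
by apply/andP; split; apply: lt0r_neq0; lra.
Qed.

(* U-centering subtracts from A s t a function of s and a function of t, which
   [qdiff] does not see, and makes the row sums vanish, so [sum_qdiff] applies. *)
Lemma Udot_Ucenter (A B : 'M[R]_n) : (4 <= n)%N ->
  (forall s t, A s t = A t s) -> (forall s t, B s t = B t s) ->
  (forall s, A s s = 0) -> (forall s, B s s = 0) ->
  Udot (Ucenter A) (Ucenter B) = qmean (fun j => 4^-1 * (qdiff A j * qdiff B j)).
Proof.
move=> n4 sA sB A0 B0; rewrite /Udot /qmean -mulr_sumr.
have symU (C : 'M[R]_n) : (forall s t, C s t = C t s) ->
    forall s t, Ucenter C s t = Ucenter C t s.
  move=> sC s t; rewrite !mxE eq_sym; case: eqP => // _; rewrite (sC s t).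
  under [\sum_v C s v]eq_bigr => v _ do rewrite sC.
  under [\sum_v C t v]eq_bigr => v _ do rewrite sC.
  by ring.
have diagU (C : 'M[R]_n) s : Ucenter C s s = 0 by rewrite mxE eqxx.
transitivity ((n ^_ 4)%:R^-1 * (4^-1 *
   \sum_(j : 4.-tuple 'I_n | uniq j) qdiff (Ucenter A) j * qdiff (Ucenter B) j)).
  (* Dividing the factor 4 (n - 1) (n - 2) by n (n - 1) (n - 2) (n - 3) leaves 4 / (n (n - 3)): the
     normalization of [Udot], and the 4 that the weight 1/4 compensates. *)
  rewrite sum_qdiff; try by [apply: symU | move=> s; exact: diagU | move=> s; exact: sum_Ucenter].
  set S := \sum_s \sum_t _; set S' := \sum_s \sum_(t | _) _.
  have -> : S' = S.
    apply: eq_bigr => s _; rewrite [RHS](bigD1 s) //= diagU mul0r add0r.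
    by apply: eq_bigl => t; rewrite eq_sym.
  have : 4%:R <= n%:R :> R by rewrite ler_nat.
  rewrite ffact4 => ?; field.
  by rewrite !lt0r_neq0 //; lra.
by congr (_ * (_ * _)); apply: eq_bigr => j uj; rewrite !qdiff_Ucenter.
Qed.

Definition sqdist p (xs : 'I_n -> p.-tuple R) (s t : 'I_n) : R :=
  edist (xs s) (xs t) ^+ 2.

Lemma edist_sqr p (x y : p.-tuple R) :
  edist x y ^+ 2 = \sum_(i < p) (tnth x i - tnth y i) ^+ 2.
Proof. by rewrite sqr_sqrtr // sumr_ge0 // => i _; apply: sqr_ge0. Qed.

(* Polarization: the inner product of X_s - X_t and X_u - X_v is a combination
   of four squared distances. *)
Lemma qdiff_sqdist p (xs : 'I_n -> p.-tuple R) j :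
  qdiff (sqdist xs) j = - 2 * \sum_(i < p)
    (tnth (xs (q0 j)) i - tnth (xs (q1 j)) i) * (tnth (xs (q2 j)) i - tnth (xs (q3 j)) i).
Proof.
rewrite /qdiff /sqdist !edist_sqr -!sumrB -big_split /= mulr_sumr.
by apply: eq_bigr => i _; ring.
Qed.

(** The kernel of [cov2] is a product, so summing over both coordinates gives the product of the two
    inner products of differences. Polarization puts a factor -2 on each of them, whence 1/16 = 1/4
    divided by 4. *)
Lemma sum_cov2E p q (xs : 'I_n -> p.-tuple R) (ys : 'I_n -> q.-tuple R) :
  sum_cov2 xs ys =
  qmean (fun j => 16^-1 * (qdiff (sqdist xs) j * qdiff (sqdist ys) j)).
Proof.
rewrite /sum_cov2.
under eq_bigr => i _ do under eq_bigr => k _ do rewrite cov2E /qmean.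
under eq_bigr => i _ do rewrite -mulr_sumr exchange_big /=.
rewrite -mulr_sumr exchange_big /=; congr (_ * _); apply: eq_bigr => j _.
rewrite !qdiff_sqdist.
set SX := (X in - 2 * X * _); set SY := (X in _ * (- 2 * X)).
have -> : 16^-1 * (- 2 * SX * (- 2 * SY)) = 4^-1 * (SX * SY) by field.
rewrite /SX mulr_suml mulr_sumr; apply: eq_bigr => i _.
rewrite /SY !mulr_sumr; apply: eq_bigr => k _.
by rewrite /cov_kernel; ring.
Qed.

End QuadMean.

(** * Cauchy-Schwarz over quadruples *)

Section QuadBounds.
Context {R : realType} {n : nat}.
Implicit Types (F G : 4.-tuple 'I_n -> R) (A B : 'I_n -> 'I_n -> R).

Lemma qmeanD F G : qmean (fun j => F j + G j) = qmean F + qmean G.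
Proof. by rewrite /qmean big_split mulrDr. Qed.

Lemma qmeanZ (c : R) F : qmean (fun j => c * F j) = c * qmean F.
Proof. by rewrite /qmean -mulr_sumr; ring. Qed.

Lemma eq_qmean F G : (forall j : 4.-tuple 'I_n, uniq j -> F j = G j) -> qmean F = qmean G.
Proof. by move=> FG; congr (_ * _); apply: eq_bigr. Qed.

Lemma ler_qmean F G : (forall j : 4.-tuple 'I_n, uniq j -> F j <= G j) -> qmean F <= qmean G.
Proof. by move=> FG; rewrite ler_wpM2l ?invr_ge0 // ler_sum. Qed.

Lemma qmean_ge0 F : (forall j : 4.-tuple 'I_n, uniq j -> 0 <= F j) -> 0 <= qmean F.
Proof. by move=> F0; rewrite mulr_ge0 ?invr_ge0 // sumr_ge0. Qed.

(** Lagrange's identity: the double sum of squares (x_i y_k - x_k y_i)^2 is twice the difference of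
    the two sides. *)
Lemma sum_cauchy_schwarz (I : finType) (S : pred I) (x y : I -> R) :
  (\sum_(i | S i) x i * y i) ^+ 2 <=
  (\sum_(i | S i) x i ^+ 2) * (\sum_(i | S i) y i ^+ 2).
Proof.
have : 0 <= \sum_(i | S i) \sum_(k | S k) (x i * y k - x k * y i) ^+ 2.
  by do 2!(apply: sumr_ge0 => ? _); apply: sqr_ge0.
have -> : \sum_(i | S i) \sum_(k | S k) (x i * y k - x k * y i) ^+ 2 =
    \sum_(i | S i) \sum_(k | S k) (x i ^+ 2 * y k ^+ 2 + y i ^+ 2 * x k ^+ 2
      - 2 * ((x i * y i) * (x k * y k))).
  by apply: eq_bigr => i _; apply: eq_bigr => k _; ring.
under eq_bigr => i _ do rewrite sumrB big_split /= -!mulr_sumr.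
rewrite sumrB big_split /= -mulr_sumr -!mulr_suml.
by move=> ?; nra.
Qed.

Lemma qmean_cauchy_schwarz F G (x y : R) : 0 <= x -> 0 <= y ->
  qmean (fun j => F j ^+ 2) <= x ^+ 2 -> qmean (fun j => G j ^+ 2) <= y ^+ 2 ->
  `|qmean (fun j => F j * G j)| <= x * y.
Proof.
move=> x0 y0 Fx Gy; rewrite -(@ler_pXn2r _ 2) ?nnegrE ?mulr_ge0 //.
rewrite real_normK ?num_real // [(x * y) ^+ 2]exprMn; apply: (@le_trans _ _
  (qmean (fun j => F j ^+ 2) * qmean (fun j => G j ^+ 2))); last first.
  by apply: ler_pM => //; apply: qmean_ge0 => j _; apply: sqr_ge0.

rewrite /qmean exprMn [leRHS]mulrACA -[X in _ <= X * _]expr2 ler_wpM2l ?sqr_ge0 //.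
exact: sum_cauchy_schwarz.
Qed.

(** The four entries of [qdiff], all with sign +. Applied to squared entries it dominates [qdiff]
    squared, up to the factor 4. *)
Definition qtot A (j : 4.-tuple 'I_n) : R :=
  A (q0 j) (q2 j) + A (q0 j) (q3 j) + A (q1 j) (q2 j) + A (q1 j) (q3 j).

Lemma uniq_qs (j : 4.-tuple 'I_n) : uniq j ->
  [/\ q0 j != q2 j, q0 j != q3 j, q1 j != q2 j & q1 j != q3 j].
Proof.
rewrite [in uniq _](tuple4E j) /= !inE !negb_or !andbT.
by move=> /and3P [/and3P [? ? ?] /andP [? ?] _].
Qed.

Lemma ler_qtot A B (j : 4.-tuple 'I_n) : (forall s t, s != t -> A s t <= B s t) -> uniq j ->
  qtot A j <= qtot B j.
Proof. by move=> AB /uniq_qs[]; do 4!move=> /AB ?; rewrite /qtot; lra. Qed.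

Lemma qdiff_sqr A j : qdiff A j ^+ 2 <= 4 * qtot (fun s t => A s t ^+ 2) j.
Proof.
rewrite /qdiff /qtot.
move: (A (q0 j) (q2 j)) (A (q0 j) (q3 j)) (A (q1 j) (q2 j)) (A (q1 j) (q3 j)) => a b c e.
(* These six squares add up to exactly 4 (a^2 + b^2 + c^2 + e^2) - (a - b - c + e)^2. *)
have := sqr_ge0 (a + b); have := sqr_ge0 (a + c); have := sqr_ge0 (a - e).
have := sqr_ge0 (b - c); have := sqr_ge0 (b + e); have := sqr_ge0 (c + e).
by nra.
Qed.

Lemma qmean_qdiff_bound A B (x y : R) : 0 <= x -> 0 <= y ->
  qmean (qtot (fun s t => A s t ^+ 2)) <= x ^+ 2 ->
  qmean (qtot (fun s t => B s t ^+ 2)) <= y ^+ 2 ->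
  `|qmean (fun j => qdiff A j * qdiff B j)| <= 4 * (x * y).
Proof.
have H (C : 'I_n -> 'I_n -> R) z : qmean (qtot (fun s t => C s t ^+ 2)) <= z ^+ 2 ->
    qmean (fun j => qdiff C j ^+ 2) <= (2 * z) ^+ 2.
  move=> Cz; apply: (@le_trans _ _ (qmean (fun j => 4 * qtot (fun s t => C s t ^+ 2) j))).
    by apply: ler_qmean => j _; apply: qdiff_sqr.
  by rewrite qmeanZ exprMn; lra.
move=> x0 y0 Ax By; have -> : 4 * (x * y) = (2 * x) * (2 * y) by ring.
by apply: qmean_cauchy_schwarz; rewrite ?mulr_ge0 //; apply: H.
Qed.

End QuadBounds.

(** * Median bandwidth and expansion of the kernels *)

Section Median.
Context {R : realType}.

(** In a nonempty list both middle positions are below the size, so the default 0 of [nth] does not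
    occur and both order statistics lie in [lo, hi]. *)
Lemma median_bounds (s : seq R) (lo hi : R) : s != [::] ->
  (forall x, x \in s -> lo <= x <= hi) -> lo <= median s <= hi.
Proof.
move=> s0 sP; rewrite /median; set t := sort _ s.
have tP i : (i < size t)%N -> lo <= nth 0 t i <= hi.
  by move=> it; apply: sP; rewrite -(mem_sort <=%R) mem_nth.
have st : (0 < size t)%N by rewrite size_sort lt0n size_eq0.
have /andP[? ?] : lo <= nth 0 t (size t).-1./2 <= hi by apply: tP; lia.
have /andP[? ?] : lo <= nth 0 t (size t)./2 <= hi by apply: tP; lia.
by apply/andP; split; lra.
Qed.

Lemma bandwidth_bounds n p (xs : 'I_n -> p.-tuple R) (lo hi : R) : (1 < n)%N ->
  (forall s t, s != t -> lo <= edist (xs s) (xs t) <= hi) ->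
  lo <= bandwidth xs <= hi.
Proof.
move=> n1 H; apply: median_bounds.
  rewrite -size_eq0 size_map -cardE -lt0n; apply/card_gt0P.
  by exists (Ordinal (ltnW n1), Ordinal n1); rewrite inE.
by move=> x /mapP[[s t]]; rewrite mem_enum inE /= => st ->; apply: H.
Qed.

End Median.

Section Taylor.
Context {R : realType}.

(** By the mean value theorem h y - h x = h'(c) (y - x) with c between x and y, and the Lipschitz
    bound gives |h'(c) - h'(x)| <= C |y - x|. *)
Lemma C1_taylor1 (h : R -> R) : C1_pos h -> lipschitz_near1 (derive1 h : R -> R) ->
  exists2 r : R, 0 < r <= 1 & exists2 C : R, 0 <= C &
    forall x y, `|x - 1| < r -> `|y - 1| < r ->
      `|h y - h x - derive1 h x * (y - x)| <= C * (y - x) ^+ 2.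
Proof.
(* A radius at most 1 keeps x and y positive, where [C1_pos] applies. |C| is taken below because the
   sign of C is not prescribed. *)
move=> hC [r0 r00 [C HC]]; exists (Num.min r0 1); first by rewrite lt_min r00 ltr01 ge_min lexx orbT.
exists `|C|; first exact: normr_ge0.
move=> x y; rewrite !lt_min => /andP[xr x1] /andP[yr y1].
have hder (z : R) : 0 < z -> is_derive z 1 h (derive1 h z).
  by move=> /hC[? _]; rewrite derive1E; apply: derivableP.
have hcont (z : R) : 0 < z -> {for z, continuous h}.
  by move=> /hC[? _]; apply: differentiable_continuous; apply/derivable1_diffP.
have x0 : 0 < x by move: x1; rewrite ltr_norml; lra.
have y0 : 0 < y by move: y1; rewrite ltr_norml; lra.
have seg (u v : R) : 0 < u -> u <= v -> exists2 c, c \in `[u, v] & h v - h u = derive1 h c * (v - u).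
  move=> u0 uv; apply: (MVT_segment uv) => [z|].
    by rewrite in_itv /= => /andP[uz _]; apply: hder; apply: lt_trans uz.
  apply: continuous_in_subspaceT => z; rewrite inE /= in_itv /= => /andP[uz _].
  by apply: hcont; apply: lt_le_trans uz.
have [c [cr cx hc]] : exists c, [/\ `|c - 1| < r0, `|c - x| <= `|y - x| &
    h y - h x = derive1 h c * (y - x)].
  case: (leP x y) => xy.
    have [c] := seg x y x0 xy; rewrite in_itv /= => /andP[xc cy] hc; exists c; split=> //.
      by move: xr yr; rewrite !ltr_norml; lra.
    by rewrite !ger0_norm; lra.
  have [c] := seg y x y0 (ltW xy); rewrite in_itv /= => /andP[yc cx] hc; exists c; split.
  - by move: xr yr; rewrite !ltr_norml; lra.
  - by rewrite !ler0_norm; lra.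
  - by rewrite -[LHS]opprB hc; ring.
rewrite hc -mulrBl normrM.
have := HC c x cr xr => /le_trans H.
apply: (@le_trans _ _ (`|C| * `|y - x| * `|y - x|)); last first.
  by rewrite -mulrA -expr2 real_normK ?num_real.
rewrite ler_wpM2r //; apply: H; apply: (@le_trans _ _ (`|C| * `|c - x|)).
  by rewrite ler_wpM2r // ler_norm.
by rewrite ler_wpM2l.
Qed.

End Taylor.

Section KernelExpansion.
Context {R : realType}.

(** The factor u + 1 is at least 1: a bound on the deviation of squared distances passes to the
    distances themselves without loss. *)
Lemma sqrt_dev (u : R) : 0 <= u -> `|u - 1| <= `|u ^+ 2 - 1|.
Proof.
move=> u0; have -> : u ^+ 2 - 1 = (u - 1) * (u + 1) by ring.
rewrite normrM [`|u + 1|]ger0_norm ?addr_ge0 //.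
by have := normr_ge0 (u - 1); nra.
Qed.

Lemma edist_Ldev (t : R) p (x y : p.-tuple R) : 0 < t ->
  edist x y / t >= 0 /\ Ldev t x y = (edist x y / t) ^+ 2 - 1.
Proof.
move=> t0; split; first by rewrite divr_ge0 ?sqrtr_ge0 ?ltW.
by rewrite /Ldev; field; rewrite lt0r_neq0.
Qed.

(** All distances, hence their median, lie in [(1 - e) t, (1 + e) t]. The constants come from 1 / (1
    - e) <= 1 + 2 e and (1 + e) / (1 - e) <= 1 + 4 e, valid up to e = 1/2. *)
Lemma bandwidth_concentration (t e : R) n p (xs : 'I_n -> p.-tuple R) :
  0 < t -> (1 < n)%N -> 0 < e <= 1 / 2 ->
  (forall s u, s != u -> `|Ldev t (xs s) (xs u)| <= e) ->
  `|t / bandwidth xs - 1| <= 2 * e /\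
  forall s u, s != u -> `|edist (xs s) (xs u) / bandwidth xs - 1| <= 4 * e.
Proof.
move=> t0 n1 /andP[e0 e1] LP.
have uP s u : s != u -> `|edist (xs s) (xs u) / t - 1| <= e.
  move=> /LP; have [d0 ->] := edist_Ldev (xs s) (xs u) t0.
  exact: le_trans (sqrt_dev d0).
have dP s u : s != u -> (1 - e) * t <= edist (xs s) (xs u) <= (1 + e) * t.
  move=> /uP; rewrite ler_norml => /andP[? ?].
  have -> : edist (xs s) (xs u) = edist (xs s) (xs u) / t * t by rewrite divfK ?lt0r_neq0.
  by rewrite !ler_pM2r //; apply/andP; split; lra.
have /andP[b1 b2] := bandwidth_bounds n1 dP.
set g := bandwidth xs in b1 b2 *.
have g0 : 0 < g by apply: lt_le_trans b1; rewrite mulr_gt0 //; lra.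
have rP : `|t / g - 1| <= 2 * e.
  rewrite ler_distl; apply/andP; split.
    by rewrite ler_pdivlMr //; nra.
  by rewrite ler_pdivrMr //; nra.
split=> // s u /dP /andP[d1 d2]; rewrite ler_distl; apply/andP; split.
  by rewrite ler_pdivlMr //; nra.
by rewrite ler_pdivrMr //; nra.
Qed.

(** The expansion at t / gamma has increment (t / gamma) (D / t - 1), and D / t - 1 differs from L /
    2 by (D / t - 1)^2 / 2 <= L^2 / 2. The order of quantifiers matters: e and K depend on h only,
    while c0 and c may depend on the sample but not on the pair (s, u). *)
Lemma kernel_expansion (h : R -> R) : C1_pos h ->
  lipschitz_near1 (derive1 h : R -> R) ->
  exists2 e : R, 0 < e <= 1 / 2 & exists2 K : R, 0 <= K &
    forall n p (xs : 'I_n -> p.-tuple R) (t : R), 0 < t -> (1 < n)%N ->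
    (forall s u, s != u -> `|Ldev t (xs s) (xs u)| <= e) ->
    let c := derive1 h (t / bandwidth xs) * (t / bandwidth xs) in
    `|c| <= K /\ exists c0 : R, forall s u, s != u ->
      `|kernel_mx h xs s u - (c0 + c / 2 * Ldev t (xs s) (xs u))|
      <= K * Ldev t (xs s) (xs u) ^+ 2.
Proof.
move=> hC hL; have [r /andP[r0 r1] [C C0 CP]] := C1_taylor1 hC hL.
have [r' r'0 [C' C'P]] := hL.
pose m := Num.min r r'.
have [mr mr'] : m <= r /\ m <= r' by rewrite /m !ge_min !lexx orbT.
have m0 : 0 < m by rewrite lt_min r0.
(* All ratios to the bandwidth are then within 4 e = m / 2 of 1, inside both radii. *)
exists (m / 8); first by apply/andP; split; lra.
(* [Kc] bounds |c|: |t / gamma| <= 2, and h' at t / gamma differs from h'(1) by at most |C'| r'. The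
   further 4 C in K is C times (t / gamma)^2 <= 4. *)
pose Kc := 2 * (`|derive1 h 1| + `|C'| * r').
have Kc0 : 0 <= Kc by rewrite mulr_ge0 // addr_ge0 // mulr_ge0 // ltW.
exists (Kc + 4 * C); first by rewrite addr_ge0 // mulr_ge0.
move=> n p xs t t0 n1 LP c.
have e1 : 0 < m / 8 <= 1 / 2 by apply/andP; split; lra.
have [rP dP] := bandwidth_concentration t0 n1 e1 LP.
set g := bandwidth xs in c rP dP *.
(* As the inverse of 0 is 0, a zero bandwidth would make the ratio 0, too far from 1. *)
have g0 : g != 0.
  by apply/eqP => gE; move: rP; rewrite gE invr0 mulr0 sub0r normrN1; lra.
have cK : `|c| <= Kc.
  rewrite /c normrM mulrC; have ? : `|t / g| <= 2 by move: rP; rewrite !ler_norml; lra.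
  apply: ler_pM => //.
  have -> : derive1 h (t / g) = derive1 h 1 + (derive1 h (t / g) - derive1 h 1) by ring.
  apply: (le_trans (ler_normD _ _)); rewrite lerD2l.
  apply: (@le_trans _ _ (C' * `|t / g - 1|)).
    by apply: C'P; [apply: le_lt_trans rP _; lra | rewrite subrr normr0].
  apply: (@le_trans _ _ (`|C'| * `|t / g - 1|)); first by rewrite ler_wpM2r ?ler_norm.
  by rewrite ler_wpM2l //; lra.
split; first by rewrite (le_trans cK) // lerDl mulr_ge0.
exists (h (t / g)) => s u su; rewrite mxE (negPf su) -/g.
have [d0 LE] := edist_Ldev (xs s) (xs u) t0.
set L := Ldev _ _ _ in LE *; set D := edist _ _ in d0 LE *.
have := CP (t / g) (D / g).
have -> : D / g - t / g = t / g * (D / t - 1).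
  by field; rewrite g0 lt0r_neq0.
move=> /(_ ltac:(apply: le_lt_trans rP _; lra)) /(_ ltac:(apply: le_lt_trans (dP s u su) _; lra)) T.
have -> : h (D / g) - (h (t / g) + c / 2 * L) =
    (h (D / g) - h (t / g) - derive1 h (t / g) * (t / g * (D / t - 1)))
    - c / 2 * (D / t - 1) ^+ 2.
  by rewrite LE /c; field; rewrite g0 lt0r_neq0.
apply: (le_trans (ler_normB _ _)).
have dL : (D / t - 1) ^+ 2 <= L ^+ 2.
  rewrite -[leLHS]real_normK ?num_real // -[leRHS]real_normK ?num_real //.
  by rewrite ler_pXn2r ?nnegrE // LE; apply: sqrt_dev.
have t4 : (t / g) ^+ 2 <= 4 by move: rP; rewrite ler_norml => /andP[? ?]; nra.
have s0 := sqr_ge0 (D / t - 1).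
rewrite addrC mulrDl; apply: lerD.
  rewrite normrM [`|_ ^+ 2|]ger0_norm //; apply: ler_pM => //.
  by rewrite normrM [`|2^-1|]ger0_norm ?invr_ge0 //; lra.
apply: (le_trans T); rewrite exprMn.
have -> : 4 * C * L ^+ 2 = C * (4 * L ^+ 2) by ring.
apply: ler_wpM2l => //.
by apply: ler_pM => //; apply: sqr_ge0.
Qed.

End KernelExpansion.

(** * Deterministic bounds for the leading term and the remainder *)

Section Remainder.
Context {R : realType}.

Definition Lmat (t : R) n p (xs : 'I_n -> p.-tuple R) (s u : 'I_n) : R :=
  Ldev t (xs s) (xs u).

(** For 4 <= n this is four times the mean of L^k over ordered pairs of distinct indices, in the
    shape that [qmean_qdiff_bound] takes. *)
Definition Lpow (k : nat) (t : R) n p (xs : 'I_n -> p.-tuple R) : R :=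
  qmean (qtot (fun s u => Ldev t (xs s) (xs u) ^+ k)).

Lemma sum_cov2_Lmat (tx ty : R) n p q (xs : 'I_n -> p.-tuple R) (ys : 'I_n -> q.-tuple R) :
  0 < tx -> 0 < ty ->
  (tx * ty)^-1 * sum_cov2 xs ys =
  tx * ty * (16^-1 * qmean (fun j => qdiff (Lmat tx xs) j * qdiff (Lmat ty ys) j)).
Proof.
have H (t : R) m (zs : 'I_n -> m.-tuple R) j : 0 < t ->
    qdiff (sqdist zs) j = t ^+ 2 * qdiff (Lmat t zs) j.
  by move=> t0; rewrite /qdiff /sqdist /Lmat /Ldev; field; rewrite lt0r_neq0.
move=> tx0 ty0; rewrite sum_cov2E qmeanZ.
under eq_qmean => j _ do rewrite (H tx) // (H ty) // mulrACA.
by rewrite qmeanZ; field; rewrite !lt0r_neq0.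
Qed.

Lemma edistC p (x y : p.-tuple R) : edist x y = edist y x.
Proof. by congr Num.sqrt; apply: eq_bigr => i _; ring. Qed.

Lemma hCov2E (f g : R -> R) n p q (xs : 'I_n -> p.-tuple R) (ys : 'I_n -> q.-tuple R) :
  (4 <= n)%N ->
  hCov2 f g xs ys =
  4^-1 * qmean (fun j => qdiff (kernel_mx f xs) j * qdiff (kernel_mx g ys) j).
Proof.
move=> n4; rewrite -qmeanZ; apply: Udot_Ucenter => // [s t|s t|s|s]; rewrite !mxE ?eqxx //.
  by rewrite eq_sym edistC.
by rewrite eq_sym edistC.
Qed.

Lemma leading_bound (tx ty x2 y2 : R) n p q
    (xs : 'I_n -> p.-tuple R) (ys : 'I_n -> q.-tuple R) :
  0 < tx -> 0 < ty -> 0 <= x2 -> 0 <= y2 ->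
  Lpow 2 tx xs <= x2 ^+ 2 -> Lpow 2 ty ys <= y2 ^+ 2 ->
  `|(tx * ty)^-1 * sum_cov2 xs ys| <= tx * ty * (x2 * y2).
Proof.
move=> tx0 ty0 x20 y20 Hx Hy; rewrite sum_cov2_Lmat // normrM gtr0_norm ?mulr_gt0 //.
rewrite ler_pM2l ?mulr_gt0 // normrM gtr0_norm ?invr_gt0 //.
have := qmean_qdiff_bound x20 y20 Hx Hy.
by have := mulr_ge0 x20 y20; rewrite /Lmat; lra.
Qed.

(** With kernel = constant + (c / 2) L + error on each side, the product of the [qdiff]s splits into
    four terms. The term in L_X L_Y has weight (1/4) (c d / 4) = c d / 16 and cancels the leading
    term exactly; each of the other three contains an error. *)
Lemma remainder_bound (tx ty x2 y2 x4 y4 c c0 d d0 K : R) (f g : R -> R) n p q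
    (xs : 'I_n -> p.-tuple R) (ys : 'I_n -> q.-tuple R) :
  (4 <= n)%N -> 0 < tx -> 0 < ty -> 0 <= x2 -> 0 <= y2 -> 0 <= x4 -> 0 <= y4 ->
  Lpow 2 tx xs <= x2 ^+ 2 -> Lpow 2 ty ys <= y2 ^+ 2 ->
  Lpow 4 tx xs <= x4 ^+ 2 -> Lpow 4 ty ys <= y4 ^+ 2 ->
  0 <= K -> `|c| <= K -> `|d| <= K ->
  (forall s u, s != u -> `|kernel_mx f xs s u - (c0 + c / 2 * Ldev tx (xs s) (xs u))|
      <= K * Ldev tx (xs s) (xs u) ^+ 2) ->
  (forall s u, s != u -> `|kernel_mx g ys s u - (d0 + d / 2 * Ldev ty (ys s) (ys u))|
      <= K * Ldev ty (ys s) (ys u) ^+ 2) ->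
  `|tx * ty * hCov2 f g xs ys - c * d * ((tx * ty)^-1 * sum_cov2 xs ys)| <=
  K ^+ 2 * (tx * ty * (x2 * y4 + x4 * y2 + x4 * y4)).
Proof.
move=> n4 tx0 ty0 x20 y20 x40 y40 X2 Y2 X4 Y4 K0 cK dK fP gP.
pose E s u := kernel_mx f xs s u - (c0 + c / 2 * Ldev tx (xs s) (xs u)).
pose F s u := kernel_mx g ys s u - (d0 + d / 2 * Ldev ty (ys s) (ys u)).
pose dm (A B : 'I_n -> 'I_n -> R) := qmean (fun j => qdiff A j * qdiff B j).
(* An error at most K L^2 has square at most K^2 L^4: this is where the fourth moments enter. *)
have err (t x : R) m (zs : 'I_n -> m.-tuple R) G : Lpow 4 t zs <= x ^+ 2 ->
    (forall s u, s != u -> `|G s u| <= K * Ldev t (zs s) (zs u) ^+ 2) ->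
    qmean (qtot (fun s u => G s u ^+ 2)) <= (K * x) ^+ 2.
  move=> Zx GP; apply: (@le_trans _ _ (qmean (fun j => K ^+ 2 *
      qtot (fun s u => Ldev t (zs s) (zs u) ^+ 4) j))); last first.
    by rewrite qmeanZ exprMn ler_wpM2l ?sqr_ge0.
  apply: ler_qmean => j uj; apply: (@le_trans _ _
      (qtot (fun s u => (K * Ldev t (zs s) (zs u) ^+ 2) ^+ 2) j)).
    apply: ler_qtot => // s u /GP GK.
    rewrite -[leLHS]real_normK ?num_real // ler_pXn2r ?nnegrE //.
    exact: le_trans GK.
  by rewrite /qtot le_eqVlt; apply/orP; left; apply/eqP; ring.
have EE := err _ _ _ _ E X4 fP; have FF := err _ _ _ _ F Y4 gP.
have -> : tx * ty * hCov2 f g xs ys - c * d * ((tx * ty)^-1 * sum_cov2 xs ys) =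
    tx * ty * (4^-1 * (c / 2 * dm (Lmat tx xs) F + d / 2 * dm E (Lmat ty ys) + dm E F)).
  rewrite sum_cov2_Lmat // hCov2E //.
  have -> : qmean (fun j => qdiff (kernel_mx f xs) j * qdiff (kernel_mx g ys) j) =
     c * d / 4 * dm (Lmat tx xs) (Lmat ty ys) + (c / 2 * dm (Lmat tx xs) F
       + d / 2 * dm E (Lmat ty ys) + dm E F).
    rewrite /dm -!qmeanZ -!qmeanD; apply: eq_qmean => j _.
    by rewrite /qdiff /E /F /Lmat; field.
  by rewrite /dm; field.
have B1 := qmean_qdiff_bound x20 (mulr_ge0 K0 y40) X2 FF.
have B2 := qmean_qdiff_bound (mulr_ge0 K0 x40) y20 EE Y2.
have B3 := qmean_qdiff_bound (mulr_ge0 K0 x40) (mulr_ge0 K0 y40) EE FF.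
rewrite normrM gtr0_norm ?mulr_gt0 //.
have -> : K ^+ 2 * (tx * ty * (x2 * y4 + x4 * y2 + x4 * y4)) =
  tx * ty * (K ^+ 2 * (x2 * y4 + x4 * y2 + x4 * y4)) by ring.
rewrite ler_pM2l ?mulr_gt0 // normrM gtr0_norm ?invr_gt0 //.
apply: (@le_trans _ _ (4^-1 * (K / 2 * (4 * (x2 * (K * y4))) + K / 2 * (4 * (K * x4 * y2))
   + 4 * (K * x4 * (K * y4))))).
  rewrite ler_wpM2l ?invr_ge0 //.
  apply: (le_trans (ler_normD _ _)); apply: lerD => //.
  by apply: (le_trans (ler_normD _ _)); apply: lerD;
    rewrite normrM; apply: ler_pM => //; rewrite normrM [`|2^-1|]gtr0_norm ?invr_gt0 //;
    rewrite ler_wpM2r ?invr_ge0.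
have p1 := mulr_ge0 (sqr_ge0 K) (mulr_ge0 x20 y40).
have p2 := mulr_ge0 (sqr_ge0 K) (mulr_ge0 x40 y20).
have p3 := mulr_ge0 (sqr_ge0 K) (mulr_ge0 x40 y40).
by lra.
Qed.

End Remainder.

(** * Measurability of the sample statistics *)

Section Measurability.
Context {d} {T : measurableType d} {R : realType}.
Local Open Scope classical_set_scope.

(** Kernels, their derivatives and the inverse are only known to be continuous on the open
    half-line, whereas a distance or a bandwidth may vanish. On phi = 0 the composition is the
    constant h 0, so that event is split off. *)
Lemma measurable_fun_comp_pos (h : R -> R) (phi : T -> R) :
  (forall x, 0 < x -> {for x, continuous h}) ->
  measurable_fun setT phi -> (forall w, 0 <= phi w) ->
  measurable_fun setT (h \o phi).
Proof.
move=> hc mphi phi0.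
have -> : h \o phi = fun w => if 0 < phi w then (h \_ `]0, +oo[) (phi w) else h 0.
  apply/funext => w /=; have := phi0 w; rewrite le_eqVlt => /predU1P[<-|p0].
    by rewrite ltxx.
  by rewrite p0 patchE mem_set //= in_itv /= p0.
apply: measurable_fun_ifT.
- by apply: measurable_fun_ltr => //; apply: measurable_cst.
- apply: (measurableT_comp _ mphi).
  apply/(measurable_restrictT h) => //.
  apply: open_continuous_measurable_fun; first exact: interval_open.
  by move=> x; rewrite inE /= in_itv /= andbT; apply: hc.
- exact: measurable_cst.
Qed.

Lemma measurable_fun_sqrtr (phi : T -> R) : (forall w, 0 <= phi w) ->
  measurable_fun setT phi -> measurable_fun setT (fun w => Num.sqrt (phi w)).
Proof.
by move=> phi0 mphi; apply: (@measurable_fun_comp_pos Num.sqrt) => // x _; apply: sqrt_continuous.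
Qed.

Lemma measurable_fun_invr (phi : T -> R) : (forall w, 0 <= phi w) ->
  measurable_fun setT phi -> measurable_fun setT (fun w => (phi w)^-1).
Proof.
move=> phi0 mphi; apply: (@measurable_fun_comp_pos GRing.inv) => // x x0.
by apply: inv_continuous; rewrite lt0r_neq0.
Qed.

Lemma measurable_fun_bigsum (I : Type) (s : seq I) (Q : pred I) (h : I -> T -> R) :
  (forall i, Q i -> measurable_fun setT (h i)) ->
  measurable_fun setT (fun w => \sum_(i <- s | Q i) h i w).
Proof.
move=> mh; under eq_fun => w do rewrite big_mkcond /=.
apply: (measurable_sum s (h := fun i w => if Q i then h i w else 0)) => i /=.
case: (boolP (Q i)) => Qi; first exact: mh.
exact: measurable_cst.
Qed.

(** This replaces an order statistic by a count of indicators, whose measurability in the entries is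
    immediate; [measurable_fun_nth_sort] rests on it. *)
Lemma nth_sorted_le (t : seq R) (c : R) k : sorted <=%R t -> (k < size t)%N ->
  (nth 0 t k <= c) = (k < count (fun x => (x <= c)%R) t)%N.
Proof.
move=> st kt; have tr : transitive (<=%R : rel R) by exact: le_trans.
have ctE m : count (fun x => (x <= c)%R) t = (count (fun x => (x <= c)%R) (take m t)
    + count (fun x => (x <= c)%R) (drop m t))%N by rewrite -count_cat cat_take_drop.
apply/idP/idP => H.
  suff : all (fun x => (x <= c)%R) (take k.+1 t).
    by rewrite all_count size_take_min (ctE k.+1) => /eqP ->; rewrite (minn_idPl kt) leq_addr.
  apply/(all_nthP 0) => i; rewrite size_take_min leq_min => /andP[ik it].
  rewrite nth_take //; apply: le_trans H.
  by rewrite (sorted_leq_nth tr (@lexx _ _) 0 st) ?inE //; lia.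
rewrite leNgt; apply/negP => ck.
have E0 : count (fun x => (x <= c)%R) (drop k t) = 0%N.
  apply/eqP; rewrite -leqn0 leqNgt -has_count; apply/hasPn => x /(nthP 0)[i].
  rewrite size_drop => it <-; rewrite nth_drop -ltNge; apply: lt_le_trans ck _.
  by rewrite (sorted_leq_nth tr (@lexx _ _) 0 st) ?inE /= ?leq_addr //; move: it; rewrite ltn_subRL.
move: H; rewrite (ctE k) E0 addn0.
by have := count_size (fun x => (x <= c)%R) (take k t); rewrite size_take kt; lia.
Qed.

Lemma measurable_fun_nth_sort (I : Type) (s : seq I) (h : I -> T -> R) k :
  (forall i, measurable_fun setT (h i)) ->
  measurable_fun setT (fun w => nth 0 (sort <=%R [seq h i w | i <- s]) k).
Proof.
move=> mh; case: (ltnP k (size s)) => ks; last first.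
  under eq_fun => w do rewrite nth_default ?size_sort ?size_map //.
  exact: measurable_cst.
move=> mT; apply: (measurability _ (RGenOInfty.measurableE R)) => //.
move=> _ [_ [r ->] <-]; rewrite setTI.
have mcount : measurable_fun setT (fun w => count (fun x => (x <= r)%R) [seq h i w | i <- s]).
  elim: s {ks} => [|i s IHs] /=; first exact: measurable_cst.
  apply: measurable_fun_addn => //.
  have mb : measurable_fun setT (fun w => h i w <= r).
    by apply: measurable_fun_ler => //; apply: measurable_cst.
  exact: (measurableT_comp _ mb).
have mlt : measurable_fun setT
    (fun w => (k < count (fun x => (x <= r)%R) [seq h i w | i <- s])%N).
  by apply: measurable_fun_ltn => //; apply: measurable_cst.
have cE w : (k < count (fun x => (x <= r)%R) [seq h i w | i <- s])%N =
    (nth 0 (sort <=%R [seq h i w | i <- s]) k <= r).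
  rewrite nth_sorted_le ?size_sort ?size_map ?count_sort //.
  by apply: sort_sorted; apply: le_total.
have := mlt mT [set false] Logic.I; rewrite setTI; congr measurable.
apply/seteqP; split => w /=; rewrite in_itv /= andbT ltNge cE.
  by move=> ->.
by move=> /negbTE.
Qed.

Lemma measurable_fun_median (I : Type) (s : seq I) (h : I -> T -> R) :
  (forall i, measurable_fun setT (h i)) ->
  measurable_fun setT (fun w => median [seq h i w | i <- s]).
Proof.
move=> mh; rewrite /median; under eq_fun => w do rewrite size_sort size_map.
apply: measurable_funM; last exact: measurable_cst.
by apply: measurable_funD; apply: measurable_fun_nth_sort.
Qed.

End Measurability.

Section SampleMeasurability.
Context {d} {T : measurableType d} {R : realType}.

Lemma measurable_fun_edist p (x y : T -> p.-tuple R) :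
  measurable_fun setT x -> measurable_fun setT y ->
  measurable_fun setT (fun w => edist (x w) (y w)).
Proof.
move=> mx my; apply: measurable_fun_sqrtr.
  by move=> w; apply: sumr_ge0 => i _; apply: sqr_ge0.
apply: measurable_fun_bigsum => i _; apply: measurable_funX.
by apply: measurable_funB; apply: (measurableT_comp (measurable_tnth i)).
Qed.

Context {n p : nat} (xs : 'I_n -> T -> p.-tuple R).
Hypothesis mxs : forall s, measurable_fun setT (xs s).

Lemma measurable_fun_bandwidth :
  measurable_fun setT (fun w => bandwidth (fun s => xs s w)).
Proof.
by apply: measurable_fun_median => st; apply: measurable_fun_edist.
Qed.

Lemma bandwidth_ge0 (zs : 'I_n -> p.-tuple R) : 0 <= bandwidth zs.
Proof.
rewrite /bandwidth /median; set t := sort _ _.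
have tP i : 0 <= nth 0 t i.
  case: (ltnP i (size t)) => it; last by rewrite nth_default.
  have := mem_nth 0 it; rewrite mem_sort => /mapP[st _ ->].
  exact: sqrtr_ge0.
by rewrite divr_ge0 // addr_ge0.
Qed.

Lemma measurable_fun_Ldev (t : R) s u :
  measurable_fun setT (fun w => Ldev t (xs s w) (xs u w)).
Proof.
rewrite /Ldev; apply: measurable_funM; last exact: measurable_cst.
apply: measurable_funB; last exact: measurable_cst.
by apply: measurable_funX; apply: measurable_fun_edist.
Qed.

Lemma measurable_fun_kernel_mx (f : R -> R) s u : C1_pos f ->
  measurable_fun setT (fun w => kernel_mx f (fun s => xs s w) s u).
Proof.
move=> fC; under eq_fun => w do rewrite mxE.
case: (s == u); first exact: measurable_cst.
apply: (@measurable_fun_comp_pos _ _ _ f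
  (fun w => edist (xs s w) (xs u w) / bandwidth (fun s => xs s w))).
- move=> x /fC[? _]; apply: differentiable_continuous; exact/derivable1_diffP.
- apply: measurable_funM; first exact: measurable_fun_edist.
  by apply: measurable_fun_invr => [w|]; [exact: bandwidth_ge0 | exact: measurable_fun_bandwidth].
- by move=> w; rewrite divr_ge0 ?sqrtr_ge0 ?bandwidth_ge0.
Qed.

Lemma measurable_fun_ratio (t : R) :
  measurable_fun setT (fun w => t / bandwidth (fun s => xs s w)).
Proof.
apply: measurable_funM; first exact: measurable_cst.
by apply: measurable_fun_invr => [w|]; [exact: bandwidth_ge0 | exact: measurable_fun_bandwidth].
Qed.

Lemma measurable_fun_derive_ratio (f : R -> R) (t : R) : C1_pos f -> 0 <= t ->
  measurable_fun setT (fun w => derive1 f (t / bandwidth (fun s => xs s w))).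
Proof.
move=> fC t0; apply: (@measurable_fun_comp_pos _ _ _ (derive1 f)).
- by move=> x /fC[].
- exact: measurable_fun_ratio.
- by move=> w; rewrite divr_ge0 ?bandwidth_ge0.
Qed.

Lemma measurable_fun_qmean (h : T -> 4.-tuple 'I_n -> R) :
  (forall j, measurable_fun setT (h^~ j)) -> measurable_fun setT (fun w => qmean (h w)).
Proof.
move=> mh; apply: measurable_funM; first exact: measurable_cst.
by apply: measurable_fun_bigsum => j _; apply: mh.
Qed.

Lemma measurable_fun_Lpow k (t : R) :
  measurable_fun setT (fun w => Lpow k t (fun s => xs s w)).
Proof.
apply: measurable_fun_qmean => j.
by apply: measurable_funD; first (apply: measurable_funD; first apply: measurable_funD);
  apply: measurable_funX; apply: measurable_fun_Ldev.
Qed.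

Lemma measurable_fun_Ucenter (A : T -> 'M[R]_n) :
  (forall s u, measurable_fun setT (fun w => A w s u)) ->
  forall s u, measurable_fun setT (fun w => Ucenter (A w) s u).
Proof.
move=> mA s u; under eq_fun => w do rewrite mxE.
case: (s == u); first exact: measurable_cst.
apply: measurable_funD; first apply: measurable_funB; first apply: measurable_funB => //.
- apply: measurable_funM; first exact: measurable_cst.
  exact: measurable_fun_bigsum.
- apply: measurable_funM; first exact: measurable_cst.
  exact: measurable_fun_bigsum.
- apply: measurable_funM; first exact: measurable_cst.
  by apply: measurable_fun_bigsum => i _; apply: measurable_fun_bigsum.
Qed.

End SampleMeasurability.

Section SampleMeasurability2.
Context {d} {T : measurableType d} {R : realType} {n p q : nat}
  (xs : 'I_n -> T -> p.-tuple R) (ys : 'I_n -> T -> q.-tuple R).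
Hypotheses (mxs : forall s, measurable_fun setT (xs s))
  (mys : forall s, measurable_fun setT (ys s)).

Lemma measurable_fun_hCov2 (f g : R -> R) : C1_pos f -> C1_pos g ->
  measurable_fun setT (fun w => hCov2 f g (fun s => xs s w) (fun s => ys s w)).
Proof.
move=> fC gC; apply: measurable_funM; first exact: measurable_cst.
apply: measurable_fun_bigsum => s _; apply: measurable_fun_bigsum => u _.
apply: measurable_funM; apply: measurable_fun_Ucenter => *;
  exact: measurable_fun_kernel_mx.
Qed.

Lemma measurable_fun_sum_cov2 :
  measurable_fun setT (fun w => sum_cov2 (fun s => xs s w) (fun s => ys s w)).
Proof.
under eq_fun => w do rewrite sum_cov2E.
apply: measurable_fun_qmean => j.
have mq m (zs : 'I_n -> T -> m.-tuple R) : (forall s, measurable_fun setT (zs s)) ->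
    measurable_fun setT (fun w => qdiff (sqdist (fun s => zs s w)) j).
  move=> mzs; apply: measurable_funD; first do 2?apply: measurable_funB;
  by apply: measurable_funX; apply: measurable_fun_edist.
apply: measurable_funM; first exact: measurable_cst.
by apply: measurable_funM; apply: mq.
Qed.

End SampleMeasurability2.

(** * Expectations of nonnegative variables and laws of pairs *)

Section NonnegativeMoments.
Context {d} {T : measurableType d} {R : realType} (P : probability T R).
Local Open Scope classical_set_scope.
Local Open Scope ereal_scope.

Lemma expectationE (Z : T -> R) : 'E_P[Z] = \int[P]_w (Z w)%:E.
Proof. by rewrite unlock. Qed.

Lemma expectation_sum_le (I : Type) (s : seq I) (Q : pred I) (F : I -> T -> R) (v : I -> R) :
  (forall i, Q i -> measurable_fun setT (F i)) ->
  (forall i w, Q i -> (0 <= F i w)%R) -> (forall i, Q i -> 'E_P[F i] <= (v i)%:E) ->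
  'E_P[fun w => (\sum_(i <- s | Q i) F i w)%R] <= (\sum_(i <- s | Q i) v i)%:E.
Proof.
move=> mF F0 Fv; elim: s => [|i s IHs].
  rewrite big_nil expectationE; under eq_integral => w _ do rewrite big_nil.
  by rewrite integral0.
rewrite big_cons; case: (boolP (Q i)) => Qi; last first.
  apply: le_trans IHs; rewrite !expectationE.
  by under eq_integral => w _ do rewrite big_cons (negbTE Qi).
rewrite expectationE; under eq_integral => w _ do rewrite big_cons Qi EFinD.
rewrite ge0_integralD //.
- by rewrite EFinD; apply: leeD; [have := Fv i Qi | have := IHs]; rewrite expectationE.
- by move=> w _; rewrite lee_fin F0.
- by apply/measurable_EFinP; apply: mF.
- by move=> w _; rewrite lee_fin sumr_ge0 // => k; apply: F0.
- by apply/measurable_EFinP; apply: measurable_fun_bigsum.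
Qed.

Lemma expectationZ_le (F : T -> R) (v c : R) : measurable_fun setT F ->
  (forall w, (0 <= F w)%R) -> (0 <= c)%R -> 'E_P[F] <= v%:E ->
  'E_P[fun w => (c * F w)%R] <= (c * v)%:E.
Proof.
move=> mF F0 c0 Fv; rewrite expectationE; under eq_integral => w _ do rewrite EFinM.
rewrite ge0_integralZl_EFin //.
- by rewrite EFinM; apply: lee_wpmul2l; rewrite ?lee_fin //; move: Fv; rewrite expectationE.
- by move=> w _; rewrite lee_fin.
- exact/measurable_EFinP.
Qed.

(** The strict inequality lets the bound survive v = 0: then Z vanishes almost surely and the event
    is negligible. For v > 0 it is Markov's inequality at level M v. *)
Lemma markov_strict (Z : T -> R) (v M : R) : measurable_fun setT Z ->
  (forall w, (0 <= Z w)%R) -> (0 <= v)%R -> (0 < M)%R -> 'E_P[Z] <= v%:E ->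
  P [set w | (M * v < Z w)%R] <= M^-1%:E.
Proof.
move=> mZ Z0 v0 M0 Zv.
have mlt c : measurable [set w | (c < Z w)%R].
  have -> : [set w | (c < Z w)%R] = setT `&` Z @^-1` `]c, +oo[.
    by rewrite setTI; apply/seteqP; split => w /=; rewrite in_itv /= andbT.
  exact: mZ.
have absZ : \int[P]_w `|(Z w)%:E| = 'E_P[Z].
  by rewrite expectationE; apply: eq_integral => w _; rewrite gee0_abs // lee_fin.
move: v0; rewrite le_eqVlt => /predU1P[v0|v0].
  have E0 : 'E_P[Z] = 0 by apply/eqP; rewrite eq_le expectation_ge0 // andbT; move: Zv; rewrite -v0.
  have [/(_ _)] := ae_eq_integral_abs P measurableT ((measurable_EFinP _ _).2 mZ).
  rewrite absZ => /(_ E0) ae0 _.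
  rewrite (measure_negligible (mlt _)) ?lee_fin ?invr_ge0 ?ltW //.
  apply: negligibleS ae0 => w /=; rewrite -v0 mulr0 => Zw /(_ Logic.I) /= [] Zw0.
  by rewrite Zw0 ltxx in Zw.
have Mv0 : (0 < M * v)%R by rewrite mulr_gt0.
have := le_integral_abse P measurableT ((measurable_EFinP _ _).2 mZ) Mv0.
rewrite absZ setTI => H.
rewrite -(@lee_pmul2l _ (M * v)%:E) ?lte_fin //.
have -> : (M * v)%:E * M^-1%:E = v%:E by rewrite -EFinM mulrAC mulfV ?mul1r // lt0r_neq0.
apply: le_trans Zv; apply: le_trans H; rewrite lee_pmul2l ?lte_fin //.
apply: le_measure; rewrite ?inE //.
  have -> : [set w | (M * v)%:E <= `|(Z w)%:E|] = setT `&` Z @^-1` `[(M * v)%R, +oo[.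
    rewrite setTI; apply/seteqP; split => w /=; rewrite in_itv /= andbT lee_fin ger0_norm //.
  exact: mZ.
by move=> w /= /ltW; rewrite lee_fin ger0_norm //.
Qed.

(** The variance is unchanged by the shift c, and equals the second moment of X - c minus the square
    of its mean. *)
Lemma variance_le_sqr (X : T -> R) (c : R) : measurable_fun setT X ->
  'E_P[fun w => (X w ^+ 2)%R] < +oo -> 'V_P[X] <= 'E_P[fun w => ((X w - c) ^+ 2)%R].
Proof.
move=> mX X2.
have L2 : X \in Lfun P 2%:E.
  rewrite inE; apply/andP; split; rewrite inE //= /finite_norm unlock.
  rewrite poweR_lty //; apply: le_lt_trans X2; rewrite expectationE.
  rewrite le_eqVlt; apply/orP; left; apply/eqP; apply: eq_integral => w _ /=.
  by rewrite powR_mulrn // real_normK ?num_real.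
have L2c : (X \- cst c)%R \in Lfun P 2%:E.
  by rewrite rpredB ?lee1n //= => _; rewrite Lfun_cst.
have -> : 'V_P[X] = 'V_P[(X \- cst c)%R] by rewrite varianceB_cst_r.
rewrite varianceE //.
have Efin : 'E_P[(X \- cst c)%R] \is a fin_num.
  by rewrite expectation_fin_num // Lfun_subset12 // fin_num_measure.
have -> : 'E_P[fun w => ((X w - c) ^+ 2)%R] = 'E_P[((X \- cst c) ^+ 2)%R].
  by congr expectation; apply/funext => w.
by rewrite -(fineK Efin) -EFin_expe leeBlDr // leeDl // lee_fin sqr_ge0.
Qed.

End NonnegativeMoments.

Section PairLaw.
Context {d d'} {T : measurableType d} {S : measurableType d'} {R : realType}
  (P : probability T R).
Local Open Scope classical_set_scope.
Local Open Scope ereal_scope.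

(** Common description of (Z0, Z0') and of (Z s, Z u) with s != u: on rectangles the law of the pair
    is the product of the law of Z0 with itself. By uniqueness of product measures, all such pairs
    have the same law. *)
Definition product_pair (Z0 U V : T -> S) : Prop :=
  forall A B, measurable A -> measurable B ->
    P (U @^-1` A `&` V @^-1` B) = P (Z0 @^-1` A) * P (Z0 @^-1` B).

Lemma independent_copy_pair (Z0 Z0' : T -> S) :
  independent_copy P Z0' Z0 -> product_pair Z0 Z0 Z0'.
Proof. by move=> [sl ind] A B mA mB; rewrite ind // sl. Qed.

Lemma iid_copies_pair n (Z : 'I_n -> T -> S) (Z0 : T -> S) s u : s != u ->
  iid_copies P Z Z0 -> product_pair Z0 (Z s) (Z u).
Proof.
move=> su [sl mi] A B mA mB.
pose C i := if i == s then A else if i == u then B else setT.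
have mC i : measurable (C i) by rewrite /C; case: eqP => // _; case: eqP.
have := mi C mC; rewrite (bigD1 s) //= (bigD1 u) 1?eq_sym //=.
rewrite {2 3}/C eqxx eq_sym (negbTE su) eqxx big1; last first.
  move=> i /andP[/negbTE si /negbTE ui].
  by rewrite /C si ui preimage_setT probability_setT.
rewrite mule1 !sl // => <-; congr (P _); apply/seteqP; split => w.
  move=> [Aw Bw] i _; rewrite /C /=; case: eqP => [->|_] //.
  by case: eqP => [->|_].
move=> H; split.
  by have := H s Logic.I; rewrite /C eqxx.
by have := H u Logic.I; rewrite /C eq_sym (negbTE su) eqxx.
Qed.

Lemma integral_product_pair (Z0 : {mfun T >-> S}) (U V : T -> S) (h : S * S -> \bar R) :
  measurable_fun setT U -> measurable_fun setT V -> product_pair Z0 U V ->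
  measurable_fun setT h -> (forall z, 0 <= h z) ->
  \int[P]_w h (U w, V w) = \int[distribution P Z0 \x distribution P Z0]_z h z.
Proof.
move=> mU mV pUV mh h0.
have mUV : measurable_fun setT (fun w => (U w, V w)) by apply: measurable_fun_pair.
pose UV : {mfun T >-> (S * S)%type} := mfun_Sub (mem_set mUV).
transitivity (\int[distribution P UV]_z h z).
  by rewrite ge0_integral_distribution.
apply: eq_measure_integral => A mA _; symmetry; exact: product_measure_unique.
Qed.

Lemma expectation_copies n (Z : 'I_n -> T -> S) (Z0 Z0' : T -> S) s u (h : S * S -> R) :
  measurable_fun setT Z0 -> measurable_fun setT Z0' ->
  (forall s, measurable_fun setT (Z s)) ->
  independent_copy P Z0' Z0 -> iid_copies P Z Z0 -> s != u ->
  measurable_fun setT h -> (forall z, (0 <= h z)%R) ->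
  'E_P[fun w => h (Z s w, Z u w)] = 'E_P[fun w => h (Z0 w, Z0' w)].
Proof.
move=> mZ0 mZ0' mZ ind iid su mh h0; rewrite !expectationE.
have mh' : measurable_fun setT (EFin \o h) by apply/measurable_EFinP.
pose Z1 : {mfun T >-> S} := mfun_Sub (mem_set mZ0).
have H := @integral_product_pair Z1 _ _ (EFin \o h) _ _ _ mh'.
rewrite (H (Z s) (Z u)) //; [|exact: (iid_copies_pair su iid)].
by rewrite (H Z0 Z0') //; apply: independent_copy_pair.
Qed.

Lemma expectation_same_law (U V : T -> S) (h : S -> R) :
  measurable_fun setT U -> measurable_fun setT V -> same_law P U V ->
  measurable_fun setT h -> (forall z, (0 <= h z)%R) ->
  'E_P[fun w => h (U w)] = 'E_P[fun w => h (V w)].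
Proof.
move=> mU mV sl mh h0; rewrite !expectationE.
have mh' : measurable_fun setT (EFin \o h) by apply/measurable_EFinP.
pose U1 : {mfun T >-> S} := mfun_Sub (mem_set mU).
pose V1 : {mfun T >-> S} := mfun_Sub (mem_set mV).
have h0' z : 0 <= (EFin \o h) z by rewrite lee_fin.
transitivity (\int[distribution P U1]_z (h z)%:E); first by rewrite ge0_integral_distribution.
transitivity (\int[distribution P V1]_z (h z)%:E); last by rewrite ge0_integral_distribution.
by apply: eq_measure_integral => A mA _; apply: sl.
Qed.

(** By Tonelli the expectation is an iterated integral; for each fixed x the inner integral of (h x
    - h y)^2 is at least the variance, by [variance_le_sqr]. The factor 2 lost against the exact
    value 2 Var is harmless for positivity. *)
Lemma expectation_copy_sqr_ge (Z0 Z0' : T -> S) (h : S -> R) (a : R) :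
  (0 <= a)%R -> measurable_fun setT Z0 -> measurable_fun setT Z0' -> measurable_fun setT h ->
  independent_copy P Z0' Z0 ->
  'E_P[fun w => (h (Z0 w) ^+ 2)%R] < +oo -> a%:E <= 'V_P[fun w => h (Z0 w)] ->
  a%:E <= 'E_P[fun w => ((h (Z0 w) - h (Z0' w)) ^+ 2)%R].
Proof.
move=> a0 mZ0 mZ0' mh ind X2 aV; rewrite expectationE.
pose Z1 : {mfun T >-> S} := mfun_Sub (mem_set mZ0).
pose k (z : S * S) : \bar R := ((h z.1 - h z.2) ^+ 2)%:E.
have mk : measurable_fun setT k.
  apply/measurable_EFinP; apply: measurable_funX; apply: measurable_funB.
    by apply: (measurableT_comp mh); exact: measurable_fst.
  by apply: (measurableT_comp mh); exact: measurable_snd.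
have k0 z : 0 <= k z by rewrite lee_fin sqr_ge0.
rewrite (@integral_product_pair Z1 _ _ k mZ0 mZ0' (independent_copy_pair ind) mk k0).
rewrite fubini_tonelli1 //.
have -> : a%:E = \int[distribution P Z1]_x (cst a%:E) x.
  by rewrite integral_cst // [X in _ * X](@probability_setT _ _ _ (distribution P Z1)) mule1.
have mkx (x : S) : measurable_fun setT (fun y => k (x, y)).
  exact: (measurableT_comp mk (measurable_pair1 x)).
apply: ge0_le_integral => //.
- exact: measurable_fun_fubini_tonelli_F.
- move=> x _; apply: (le_trans aV); apply: le_trans (variance_le_sqr (h x) _ X2) _.
    exact: (measurableT_comp mh).
  rewrite expectationE /fubini_F ge0_integral_distribution //.
  rewrite le_eqVlt; apply/orP; left; apply/eqP; apply: eq_integral => w _ /=.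
  by rewrite /k /= -sqrrN opprB.
Qed.

End PairLaw.

(** * Moments of the distances in the sample *)

Section DistanceMoments.
Context {d d'} {T : measurableType d} {S : measurableType d'} {R : realType}
  (P : probability T R) {n p : nat}.
Variables (Z0 Z0' : T -> S) (Z : 'I_n -> T -> S) (phi : S -> p.-tuple R).
Hypotheses (mZ0 : measurable_fun setT Z0) (mZ0' : measurable_fun setT Z0')
  (mZ : forall s, measurable_fun setT (Z s)) (mphi : measurable_fun setT phi).
Hypotheses (ind : independent_copy P Z0' Z0) (iid : iid_copies P Z Z0).

(** Independence is assumed for the pairs (X, Y); taking [phi] to be [fst] or [snd] serves both
    components. An even power is nonnegative, so the transfer needs no integrability. *)
Lemma expectation_Ldev_copies (k : nat) (t : R) s u : ~~ odd k -> s != u ->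
  ('E_P[fun w => (Ldev t (phi (Z s w)) (phi (Z u w)) ^+ k)%R] =
   'E_P[fun w => (Ldev t (phi (Z0 w)) (phi (Z0' w)) ^+ k)%R])%E.
Proof.
move=> ek su; apply: (expectation_copies (h := fun z => Ldev t (phi z.1) (phi z.2) ^+ k)
  mZ0 mZ0' mZ ind iid su).
- apply: measurable_funX; rewrite /Ldev; apply: measurable_funM; last exact: measurable_cst.
  apply: measurable_funB; last exact: measurable_cst.
  apply: measurable_funX; apply: measurable_fun_edist.
    by apply: (measurableT_comp mphi); exact: measurable_fst.
  by apply: (measurableT_comp mphi); exact: measurable_snd.
- by move=> z; exact: exprn_even_ge0.
Qed.

Let mphiZ s : measurable_fun setT (fun w => phi (Z s w)).
Proof. exact: (measurableT_comp mphi (mZ s)). Qed.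

Definition Ltotal (t : R) (xs : 'I_n -> p.-tuple R) : R :=
  \sum_s \sum_(u | u != s) Ldev t (xs s) (xs u) ^+ 2.

Lemma Ltotal_ge0 t xs : 0 <= Ltotal t xs.
Proof. by apply: sumr_ge0 => s _; apply: sumr_ge0 => u _; apply: sqr_ge0. Qed.

Lemma Ldev_Ltotal t xs s u : s != u -> Ldev t (xs s) (xs u) ^+ 2 <= Ltotal t xs.
Proof.
move=> su; rewrite /Ltotal (bigD1 s) //= (bigD1 u) 1?eq_sym //= -addrA lerDl.
by rewrite addr_ge0 // ?Ltotal_ge0 //; do ?[apply: sumr_ge0 => ? _]; apply: sqr_ge0.
Qed.

Lemma measurable_fun_Ltotal t :
  measurable_fun setT (fun w => Ltotal t (fun s => phi (Z s w))).
Proof.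
apply: measurable_fun_bigsum => s _; apply: measurable_fun_bigsum => u _.
by apply: measurable_funX; apply: (measurable_fun_Ldev mphiZ).
Qed.

Lemma expectation_Ltotal_le (t v : R) : 0 <= v ->
  ('E_P[fun w => (Ldev t (phi (Z0 w)) (phi (Z0' w)) ^+ 2)%R] = v%:E)%E ->
  ('E_P[fun w => Ltotal t (fun s => phi (Z s w))] <= (n%:R ^+ 2 * v)%:E)%E.
Proof.
move=> v0 Ev; apply: (@le_trans _ _ (\sum_(s < n) \sum_(u < n | u != s) v)%:E).
  apply: expectation_sum_le => [s _|s w _|s _].
  - apply: measurable_fun_bigsum => u _.
    by apply: measurable_funX; apply: (measurable_fun_Ldev mphiZ).
  - by apply: sumr_ge0 => u _; apply: sqr_ge0.
  - apply: expectation_sum_le => [u _|u w _|u us].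
    + by apply: measurable_funX; apply: (measurable_fun_Ldev mphiZ).
    + exact: sqr_ge0.
    + by rewrite expectation_Ldev_copies ?Ev // eq_sym.
rewrite lee_fin; apply: (@le_trans _ _ (\sum_(s < n) \sum_(u < n) v)).
  by apply: ler_sum => s _; rewrite [leRHS](bigD1 s) //= lerDr.
by rewrite !sumr_const !card_ord -mulrnA -[leLHS]mulr_natl natrM expr2.
Qed.

Lemma Lpow_ge0 k t (xs : 'I_n -> p.-tuple R) : ~~ odd k -> 0 <= Lpow k t xs.
Proof. by move=> ek; apply: qmean_ge0 => j _; rewrite /qtot !addr_ge0 // exprn_even_ge0. Qed.

Lemma expectation_Lpow_le (k : nat) (t v : R) : ~~ odd k -> 0 <= v ->
  ('E_P[fun w => (Ldev t (phi (Z0 w)) (phi (Z0' w)) ^+ k)%R] = v%:E)%E ->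
  ('E_P[fun w => Lpow k t (fun s => phi (Z s w))] <= (4 * v)%:E)%E.
Proof.
move=> ek v0 Ev.
have mL s u : measurable_fun setT (fun w => Ldev t (phi (Z s w)) (phi (Z u w)) ^+ k).
  by apply: measurable_funX; apply: (measurable_fun_Ldev mphiZ).
have L0 s u w : 0 <= Ldev t (phi (Z s w)) (phi (Z u w)) ^+ k by exact: exprn_even_ge0.
apply: (@le_trans _ _ ((n ^_ 4)%:R^-1 * \sum_(j : 4.-tuple 'I_n | uniq j) (4 * v))%:E).
  apply: expectationZ_le.
  - by apply: measurable_fun_bigsum => j _; rewrite /qtot;
      apply: measurable_funD => //; apply: measurable_funD => //; apply: measurable_funD.
  - by move=> w; apply: sumr_ge0 => j _; rewrite /qtot !addr_ge0.
  - by rewrite invr_ge0.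
  apply: expectation_sum_le => [j _|j w _|j uj].
  - by rewrite /qtot; apply: measurable_funD => //; apply: measurable_funD => //; apply: measurable_funD.
  - by rewrite /qtot !addr_ge0.
  have [j1 j2 j3 j4] := uniq_qs uj.
  have E s u : s != u ->
      (\int[P]_w (Ldev t (phi (Z s w)) (phi (Z u w)) ^+ k)%:E = v%:E)%E.
    by move=> su; rewrite -expectationE expectation_Ldev_copies.
  rewrite expectationE /qtot; under eq_integral => w _ do rewrite !EFinD.
  have mE s u : measurable_fun setT
      (fun w => (Ldev t (phi (Z s w)) (phi (Z u w)) ^+ k)%:E) by exact/measurable_EFinP.
  rewrite !ge0_integralD //; try by move=> *; rewrite ?adde_ge0 ?lee_fin.
  - by rewrite !E // -!EFinD lee_fin; lra.
  - by apply: emeasurable_funD.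
  - by apply: emeasurable_funD => //; apply: emeasurable_funD.
rewrite lee_fin sumr_const -[X in _ * X <= _]mulr_natl.
have -> : #|(fun j : 4.-tuple 'I_n => uniq j)| = (n ^_ 4)%N.
  have := card_uniq_tuples 4 (@predT 'I_n); rewrite card_ord => <-.
  by apply: eq_card => j; rewrite !inE all_predT.
(* For n < 4 the normalized sum is 0, and 0 <= 4 v. *)
case: (eqVneq (n ^_ 4)%N 0%N) => [->|n0]; first by rewrite !mul0r mulr0 mulr_ge0.
by rewrite mulKf // pnatr_eq0.
Qed.

(** [fine] sends +oo to 0, so positivity needs finiteness as well: one coordinate gives the lower
    bound, and (x - y)^2 <= 2 x^2 + 2 y^2 summed over the coordinates the upper one. *)
Lemma tau_gt0 (a b : R) : (0 < p)%N -> 0 < a ->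
  (forall i : 'I_p, (a%:E <= 'V_P[fun w => tnth (phi (Z0 w)) i])%E /\
     ('E_P[fun w => (tnth (phi (Z0 w)) i ^+ 2)%R] <= b%:E)%E) ->
  0 < tau P (phi \o Z0) (phi \o Z0').
Proof.
move=> p0 a0 Hi.
have mt i : measurable_fun setT (fun z => tnth (phi z) i).
  exact: (measurableT_comp (measurable_tnth i) mphi).
have mt0 i : measurable_fun setT (fun w => tnth (phi (Z0 w)) i).
  exact: (measurableT_comp (mt i) mZ0).
have mt0' i : measurable_fun setT (fun w => tnth (phi (Z0' w)) i).
  exact: (measurableT_comp (mt i) mZ0').
have mphi0 : measurable_fun setT (phi \o Z0) by exact: measurableT_comp.
have mphi0' : measurable_fun setT (phi \o Z0') by exact: measurableT_comp.
have med : measurable_fun setT (fun w => edist ((phi \o Z0) w) ((phi \o Z0') w) ^+ 2).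
  by apply: measurable_funX; apply: measurable_fun_edist.
rewrite /tau sqrtr_gt0; set E := expectation _ _.
have lo : (a%:E <= E)%E.
  have [aV bE] := Hi (Ordinal p0).
  apply: (@le_trans _ _ 'E_P[fun w => ((tnth (phi (Z0 w)) (Ordinal p0)
      - tnth (phi (Z0' w)) (Ordinal p0)) ^+ 2)%R]%E).
    apply: (expectation_copy_sqr_ge (h := fun z => tnth (phi z) (Ordinal p0))) => //.
      exact: ltW.
    by apply: le_lt_trans bE _; rewrite ltry.
  apply: expectation_le => //.
  - by apply: measurable_funX; apply: measurable_funB.
  - by move=> w; apply: sqr_ge0.
  - by move=> w; apply: sqr_ge0.
  - apply: aeW => w; rewrite edist_sqr (bigD1 (Ordinal p0)) //= lerDl.
    by apply: sumr_ge0 => i _; apply: sqr_ge0.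
have hi : (E <= (\sum_(i < p) (2 * b + 2 * b))%:E)%E.
  apply: (@le_trans _ _ 'E_P[fun w => (\sum_(i < p) (2 * tnth (phi (Z0 w)) i ^+ 2
     + 2 * tnth (phi (Z0' w)) i ^+ 2))%R]%E).
    apply: expectation_le => //.
    - apply: measurable_fun_bigsum => i _; apply: measurable_funD;
      by apply: measurable_funM; [exact: measurable_cst | exact: measurable_funX].
    - by move=> w; apply: sqr_ge0.
    - by move=> w; apply: sumr_ge0 => i _; rewrite addr_ge0 // mulr_ge0 // sqr_ge0.
    - apply: aeW => w; rewrite edist_sqr; apply: ler_sum => i _ /=.
      by have := sqr_ge0 (tnth (phi (Z0 w)) i + tnth (phi (Z0' w)) i); nra.
  apply: expectation_sum_le => [i _|i w _|i _].
  - apply: measurable_funD;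
      by apply: measurable_funM; [exact: measurable_cst | exact: measurable_funX].
  - by rewrite addr_ge0 // mulr_ge0 // sqr_ge0.
  have [_ bE] := Hi i.
  have bE' : ('E_P[fun w => (tnth (phi (Z0' w)) i ^+ 2)%R] <= b%:E)%E.
    have [sl _] := ind.
    rewrite (expectation_same_law (h := fun z => tnth (phi z) i ^+ 2) mZ0' mZ0 sl) //.
    - exact: measurable_funX.
    - by move=> z; apply: sqr_ge0.
  rewrite expectationE; under eq_integral => w _ do rewrite EFinD.
  have m2 (Y : T -> R) : measurable_fun setT Y -> measurable_fun setT (fun w => (2 * Y w ^+ 2)%:E).
    by move=> mY; apply/measurable_EFinP; apply: measurable_funM; [exact: measurable_cst | exact: measurable_funX].
  rewrite ge0_integralD //; first last.
  - exact: m2.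
  - by move=> w _; rewrite lee_fin mulr_ge0 // sqr_ge0.
  - exact: m2.
  - by move=> w _; rewrite lee_fin mulr_ge0 // sqr_ge0.
  by rewrite EFinD -!expectationE; apply: leeD; apply: expectationZ_le => //;
    [exact: measurable_funX | move=> w; exact: sqr_ge0 | exact: measurable_funX | move=> w; exact: sqr_ge0].
have Efin : (E \is a fin_num)%E.
  rewrite fin_numE; apply/andP; split; apply/eqP => Ee; [move: lo | move: hi];
  by rewrite Ee.
by move: lo; rewrite -(fineK Efin) lee_fin; exact: lt_le_trans.
Qed.

End DistanceMoments.

(** * Stochastic orders from good events *)

Section GoodEvents.
Context {R : realType} {d : nat -> measure_display}
  {Omega : forall k, measurableType (d k)} (P : forall k, probability (Omega k) R).
Local Open Scope classical_set_scope.

Lemma measurable_set_ltr dd (T : measurableType dd) (U V : T -> R) :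
  measurable_fun setT U -> measurable_fun setT V -> measurable [set w | U w < V w].
Proof.
move=> mU mV; have := measurable_fun_ltr mU mV measurableT (Y := [set true]) Logic.I.
by rewrite setTI; congr measurable; apply/seteqP; split.
Qed.

(** Meant for iteration: each use removes one bad event from A at cost 1 / M and keeps the rest
    measurable. *)
Lemma markov_restrict dd (T : measurableType dd) (Q : probability T R) (Z : T -> R)
    (v M : R) (A : set T) : measurable A -> measurable_fun setT Z ->
  (forall w, 0 <= Z w) -> 0 <= v -> 0 < M -> ('E_Q[Z] <= v%:E)%E ->
  measurable (A `\` [set w | (M * v < Z w)%R]) /\
  (Q A <= Q (A `\` [set w | (M * v < Z w)%R]) + M^-1%:E)%E.
Proof.
move=> mA mZ Z0 v0 M0 Zv; set B := [set w | _].
have mB : measurable B by apply: measurable_set_ltr => //; exact: measurable_cst.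
have mAB : measurable (A `\` B) by apply: measurableD.
split=> //; apply: (@le_trans _ _ (Q (A `\` B) + Q B)%E).
  apply: le_trans (measureU2 _ mAB mB); apply: le_measure; rewrite ?inE //.
    exact: measurableU.
  by move=> w Aw; have [Bw|Bw] := pselect (B w); [right | left].
by apply: leeD => //; apply: markov_strict.
Qed.

Variable G : R -> forall k, Omega k -> Prop.
Arguments G : clear implicits.
Hypothesis G_prob : forall M : R, 0 < M -> \forall k \near \oo,
  forall A, measurable A -> (forall w, A w -> ~ G M k w) -> (P k A <= (6 / M)%:E)%E.

(** Reduces O_p to a bound on [G M] with a constant independent of k; M = 6 / e makes the failure
    probability e. [G] is a bare predicate: its hypothesis speaks of measurable sets avoiding it, so
    its own measurability never arises. *)
Lemma bigOp_good (Z W : forall k, Omega k -> R) :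
  (forall k, measurable_fun setT (Z k)) -> (forall k, measurable_fun setT (W k)) ->
  (forall M : R, 0 < M -> exists2 M' : R, 0 < M' & \forall k \near \oo,
     forall w, G M k w -> `|Z k w| <= M' * `|W k w|) -> bigOp P Z W.
Proof.
move=> mZ mW H e e0; have M0 : 0 < 6 / e by rewrite divr_gt0.
have [M' M'0 HM'] := H _ M0; exists M' => //; near=> k.
have -> : e%:E = (6 / (6 / e))%:E :> \bar R by congr EFin; field; rewrite lt0r_neq0.
have HG : forall A, measurable A -> (forall w, A w -> ~ G (6 / e) k w) ->
    (P k A <= (6 / (6 / e))%:E)%E by near: k; exact: G_prob.
have HZ : forall w, G (6 / e) k w -> `|Z k w| <= M' * `|W k w| by near: k.
apply: HG.
  apply: measurable_set_ltr; last exact: measurableT_comp.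
  by apply: measurable_funM; [exact: measurable_cst | exact: measurableT_comp].
by move=> w /= ltw /HZ; rewrite leNgt ltw.
Unshelve. all: by end_near. Qed.

End GoodEvents.

Section Little.
Context {R : realType} {d : nat -> measure_display}
  {Omega : forall k, measurableType (d k)} (P : forall k, probability (Omega k) R).
Local Open Scope classical_set_scope.

(** Once M is chosen for e, eventually |r k| <= c / M, so the event c < |Z| lies inside M |r k| <
    |Z|. *)
Lemma bigOp_littleop (Z : forall k, Omega k -> R) (r : nat -> R) :
  (forall k, measurable_fun setT (Z k)) ->
  bigOp P Z (fun k _ => r k) -> r k @[k --> \oo] --> (0 : R) ->
  littleop P Z (fun _ _ => 1).
Proof.
move=> mZ ZO r0 c c0.
have mset (a : R) k : measurable [set w | a < `|Z k w|].
  by apply: measurable_set_ltr; [exact: measurable_cst | exact: measurableT_comp].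
apply/fine_cvgP; split.
  by apply: nearW => k; apply: fin_num_measure; exact: mset.
apply/cvgrPdist_le => e e0; have [M M0 HM] := ZO e e0.
have rM : \forall k \near \oo, `|r k| <= c / M.
  move/cvgrPdist_le : r0 => /(_ (c / M)); rewrite divr_gt0 // => /(_ isT).
  by apply: filterS => k; rewrite sub0r normrN.
near=> k; rewrite sub0r normrN /=.
have HMk : (P k [set w | (M * `|r k| < `|Z k w|)%R] <= e%:E)%E by near: k.
have rMk : `|r k| <= c / M by near: k.
have Pfin : P k [set w | c * `|1| < `|Z k w|] \is a fin_num by apply: fin_num_measure; exact: mset.
rewrite ger0_norm ?fine_ge0 ?measure_ge0 // -lee_fin fineK //.
apply: le_trans HMk; apply: le_measure; rewrite ?inE; [exact: mset | exact: mset |].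
move=> w /=; apply: le_lt_trans; rewrite normr1 mulr1.
by move: rMk; rewrite ler_pdivlMr // mulrC.
Unshelve. all: by end_near. Qed.

End Little.

Section FixedSample.
Context {dd} {T : measurableType dd} {R : realType} (Q : probability T R) {n p q : nat}.
Variables (X0 X0' : {RV Q >-> p.-tuple R}) (Y0 Y0' : {RV Q >-> q.-tuple R})
  (X : 'I_n -> {RV Q >-> p.-tuple R}) (Y : 'I_n -> {RV Q >-> q.-tuple R}).
Hypotheses (ind : independent_copy Q (joint X0' Y0') (joint X0 Y0))
  (iid : iid_copies Q (fun s => joint (X s) (Y s)) (joint X0 Y0)).

(* The Markov bounds that hold outside of an event of probability 3 / M: the first
   one controls all the L's at once, the other two the errors in mean square. *)
Definition good_distances (M t al ga : R) m (zs : 'I_n -> m.-tuple R) : Prop :=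
  [/\ Ltotal t zs <= M * (n%:R ^+ 2 * al ^+ 2), Lpow 2 t zs <= M * (4 * al ^+ 2) &
    Lpow 4 t zs <= M * (4 * ga ^+ 2)].

Lemma good_Ldev_le (M t al ga e : R) m (zs : 'I_n -> m.-tuple R) s u :
  0 <= e -> M * (n%:R * al) ^+ 2 <= e ^+ 2 -> good_distances M t al ga zs -> s != u ->
  `|Ldev t (zs s) (zs u)| <= e.
Proof.
move=> e0 Me [LT _ _] su; rewrite -(@ler_pXn2r _ 2) ?nnegrE // real_normK ?num_real //.
apply: le_trans (Ldev_Ltotal t zs su) _; apply: le_trans LT _.
by rewrite -exprMn.
Qed.

Lemma good_Lpow_le (M t al ga : R) m (zs : 'I_n -> m.-tuple R) :
  0 <= M -> good_distances M t al ga zs ->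
  Lpow 2 t zs <= (2 * Num.sqrt M * al) ^+ 2 /\ Lpow 4 t zs <= (2 * Num.sqrt M * ga) ^+ 2.
Proof.
move=> M0 [_ L2 L4]; rewrite !exprMn !sqr_sqrtr //.
by split; [apply: le_trans L2 _ | apply: le_trans L4 _]; rewrite le_eqVlt;
  apply/orP; left; apply/eqP; ring.
Qed.

(** Six bad events, three for X and three for Y, are peeled off A one after the other. The set left
    over satisfies every bound, so it is empty. *)
Lemma good_distances_prob (tx ty al be ga la M : R) (A : set T) :
  0 < M -> measurable A ->
  ('E_Q[fun w => (Ldev tx (X0 w) (X0' w) ^+ 2)%R] = (al ^+ 2)%:E)%E ->
  ('E_Q[fun w => (Ldev ty (Y0 w) (Y0' w) ^+ 2)%R] = (be ^+ 2)%:E)%E ->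
  ('E_Q[fun w => (Ldev tx (X0 w) (X0' w) ^+ 4)%R] = (ga ^+ 2)%:E)%E ->
  ('E_Q[fun w => (Ldev ty (Y0 w) (Y0' w) ^+ 4)%R] = (la ^+ 2)%:E)%E ->
  (forall w, A w -> ~ (good_distances M tx al ga (fun s => X s w) /\
                       good_distances M ty be la (fun s => Y s w))) ->
  (Q A <= (6 / M)%:E)%E.
Proof.
move=> M0 mA Eal Ebe Ega Ela Abad.
have mX0 : measurable_fun setT (joint X0 Y0) by exact: measurable_fun_pair.
have mX0' : measurable_fun setT (joint X0' Y0') by exact: measurable_fun_pair.
have mZ s : measurable_fun setT (joint (X s) (Y s)) by exact: measurable_fun_pair.
have mX s : measurable_fun setT (X s) by [].
have mY s : measurable_fun setT (Y s) by [].
have e2 : ~~ odd 2 by []. have e4 : ~~ odd 4 by [].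
have step := @markov_restrict R _ _ Q.
have [m1 h1] := step _ (n%:R ^+ 2 * al ^+ 2) M A mA
  (measurable_fun_Ltotal mZ (@measurable_fst _ _ _ _) tx) (fun w => Ltotal_ge0 _ _)
  (mulr_ge0 (sqr_ge0 _) (sqr_ge0 _)) M0
  (expectation_Ltotal_le mX0 mX0' mZ (@measurable_fst _ _ _ _) ind iid (sqr_ge0 _) Eal).
have [m2 h2] := step _ (n%:R ^+ 2 * be ^+ 2) M _ m1
  (measurable_fun_Ltotal mZ (@measurable_snd _ _ _ _) ty) (fun w => Ltotal_ge0 _ _)
  (mulr_ge0 (sqr_ge0 _) (sqr_ge0 _)) M0
  (expectation_Ltotal_le mX0 mX0' mZ (@measurable_snd _ _ _ _) ind iid (sqr_ge0 _) Ebe).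
have [m3 h3] := step _ (4 * al ^+ 2) M _ m2
  (measurable_fun_Lpow mX 2 tx) (fun w => Lpow_ge0 _ _ e2)
  (mulr_ge0 (ler0n _ _) (sqr_ge0 _)) M0
  (expectation_Lpow_le mX0 mX0' mZ (@measurable_fst _ _ _ _) ind iid e2 (sqr_ge0 _) Eal).
have [m4 h4] := step _ (4 * be ^+ 2) M _ m3
  (measurable_fun_Lpow mY 2 ty) (fun w => Lpow_ge0 _ _ e2)
  (mulr_ge0 (ler0n _ _) (sqr_ge0 _)) M0
  (expectation_Lpow_le mX0 mX0' mZ (@measurable_snd _ _ _ _) ind iid e2 (sqr_ge0 _) Ebe).
have [m5 h5] := step _ (4 * ga ^+ 2) M _ m4
  (measurable_fun_Lpow mX 4 tx) (fun w => Lpow_ge0 _ _ e4)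
  (mulr_ge0 (ler0n _ _) (sqr_ge0 _)) M0
  (expectation_Lpow_le mX0 mX0' mZ (@measurable_fst _ _ _ _) ind iid e4 (sqr_ge0 _) Ega).
have [m6 h6] := step _ (4 * la ^+ 2) M _ m5
  (measurable_fun_Lpow mY 4 ty) (fun w => Lpow_ge0 _ _ e4)
  (mulr_ge0 (ler0n _ _) (sqr_ge0 _)) M0
  (expectation_Lpow_le mX0 mX0' mZ (@measurable_snd _ _ _ _) ind iid e4 (sqr_ge0 _) Ela).
set A6 := (X in (_ <= Q X + _)%E) in h6.
have A60 : A6 = set0.
  apply/seteqP; split => // w [[[[[[Aw b1] b2] b3] b4] b5] b6]; apply: (Abad w Aw).
  by split; split; rewrite leNgt; apply/negP.
have -> : (6 / M)%:E = (M^-1%:E + M^-1%:E + M^-1%:E + M^-1%:E + M^-1%:E + M^-1%:E)%E.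
  by rewrite -!EFinD; congr EFin; ring.
rewrite A60 measure0 add0e in h6.
apply: (le_trans h1); apply: leeD => //; apply: (le_trans h2); apply: leeD => //.
apply: (le_trans h3); apply: leeD => //; apply: (le_trans h4); apply: leeD => //.
by apply: (le_trans h5); apply: leeD.
Qed.

Lemma tauX_gt0 (a b : R) : (0 < p)%N -> 0 < a ->
  (forall i : 'I_p, (a%:E <= 'V_Q[fun w => tnth (X0 w) i])%E /\
     ('E_Q[fun w => (tnth (X0 w) i ^+ 2)%R] <= b%:E)%E) -> 0 < tau Q X0 X0'.
Proof.
have mX0 : measurable_fun setT (joint X0 Y0) by exact: measurable_fun_pair.
have mX0' : measurable_fun setT (joint X0' Y0') by exact: measurable_fun_pair.
exact: (tau_gt0 mX0 mX0' (@measurable_fst _ _ _ _) ind).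
Qed.

Lemma tauY_gt0 (a b : R) : (0 < q)%N -> 0 < a ->
  (forall i : 'I_q, (a%:E <= 'V_Q[fun w => tnth (Y0 w) i])%E /\
     ('E_Q[fun w => (tnth (Y0 w) i ^+ 2)%R] <= b%:E)%E) -> 0 < tau Q Y0 Y0'.
Proof.
have mX0 : measurable_fun setT (joint X0 Y0) by exact: measurable_fun_pair.
have mX0' : measurable_fun setT (joint X0' Y0') by exact: measurable_fun_pair.
exact: (tau_gt0 mX0 mX0' (@measurable_snd _ _ _ _) ind).
Qed.

End FixedSample.

(** * The kernel factor and the final assembly *)

Section KernelFactor.
Context {R : realType}.

Lemma derive_ratio_bounds (h : R -> R) : C1_pos h -> derive1 h 1 != 0 ->
  exists2 e : R, 0 < e <= 1 / 2 & exists2 m : R, 0 < m & exists2 m' : R, 0 < m' &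
    forall x, `|x - 1| <= e -> m <= `|derive1 h x * x| <= m'.
Proof.
move=> hC h0; have [_ hc] := hC 1 ltr01.
pose D := `|derive1 h 1|; have D0 : 0 < D by rewrite normr_gt0.
have /cvgrPdist_le/(_ (D / 2)) := hc; rewrite divr_gt0 // => /(_ isT).
move=> /nbhs_ballP[r /= r0 Hr].
exists (Num.min (r / 2) (1 / 2)).
  by rewrite lt_min !divr_gt0 //= ge_min lexx orbT.
(* Near 1 the derivative has modulus in [D / 2, 3 D / 2] and x lies in [1/2, 3/2]; the product is
   between D / 4 and 9 D / 4 <= 3 D. *)
exists (D / 4); first by rewrite divr_gt0.
exists (3 * D); first by rewrite mulr_gt0.
move=> x; rewrite le_min => /andP[xr x2].
have /Hr : ball (1 : R) r x.
  by rewrite /ball /= distrC; apply: le_lt_trans xr _; lra.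
rewrite /= => Hx.
have d1 : D / 2 <= `|derive1 h x|.
  have := ler_normD (derive1 h x) (derive1 h 1 - derive1 h x).
  by rewrite addrC subrK -/D; lra.
have d2 : `|derive1 h x| <= 3 / 2 * D.
  have := ler_normB (derive1 h 1) (derive1 h 1 - derive1 h x).
  by rewrite opprB addrC subrK -/D; lra.
have [x1 x3] : 1 / 2 <= `|x| /\ `|x| <= 3 / 2.
  move: x2; rewrite ler_norml => /andP[? ?].
  by rewrite ger0_norm; [split; lra | lra].
by rewrite normrM; apply/andP; split; nra.
Qed.

End KernelFactor.

Local Open Scope classical_set_scope.
Local Open Scope ring_scope.

Theorem theorem3p1p2 (R : realType)
  (d : nat -> measure_display) (Omega : forall k, measurableType (d k))
  (P : forall k, probability (Omega k) R)
  (n p q : nat -> nat)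
  (X0 X0' : forall k, {RV (P k) >-> (p k).-tuple R})
  (Y0 Y0' : forall k, {RV (P k) >-> (q k).-tuple R})
  (X : forall k, 'I_(n k) -> {RV (P k) >-> (p k).-tuple R})
  (Y : forall k, 'I_(n k) -> {RV (P k) >-> (q k).-tuple R})
  (f g : R -> R) (a b a' b' : R) :
  (forall k, independent_copy (P k) (joint (X0' k) (Y0' k)) (joint (X0 k) (Y0 k))) ->
  (forall k, iid_copies (P k) (fun s => joint (X k s) (Y k s)) (joint (X0 k) (Y0 k))) ->
  C1_pos f -> C1_pos g ->
  n k @[k --> \oo] --> \oo ->
  p k @[k --> \oo] --> \oo ->
  q k @[k --> \oo] --> \oo ->
  0 < a ->
  (forall k (i : 'I_(p k)),
     (a%:E <= 'V_(P k)[fun w => tnth (X0 k w) i])%E /\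
     ('E_(P k)[fun w => (tnth (X0 k w) i ^+ 2)%R] <= b%:E)%E) ->
  0 < a' ->
  (forall k (j : 'I_(q k)),
     (a'%:E <= 'V_(P k)[fun w => tnth (Y0 k w) j])%E /\
     ('E_(P k)[fun w => (tnth (Y0 k w) j ^+ 2)%R] <= b'%:E)%E) ->
  let tauX k := tau (P k) (X0 k) (X0' k) in
  let tauY k := tau (P k) (Y0 k) (Y0' k) in
  let tauXY k := tauX k * tauY k in
  let gamX k w := bandwidth (fun s => X k s w) in
  let gamY k w := bandwidth (fun s => Y k s w) in
  let factor k (w : Omega k) :=
    derive1 f (tauX k / gamX k w) * derive1 g (tauY k / gamY k w)
    * (tauX k / gamX k w) * (tauY k / gamY k w) in
  let leading k (w : Omega k) :=
    (tauXY k)^-1 * sum_cov2 (fun s => X k s w) (fun s => Y k s w) in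
  exists Rn : forall k, Omega k -> R,
    (forall k (w : Omega k),
       tauXY k * hCov2 f g (fun s => X k s w) (fun s => Y k s w)
       = factor k w * leading k w + Rn k w)
    /\
    (forall alpha beta gamma lambda : nat -> R,
       (forall k, 0 <= alpha k /\
          'E_(P k)[fun w => (Ldev (tauX k) (X0 k w) (X0' k w) ^+ 2)%R]%E
            = (alpha k ^+ 2)%:E) ->
       (forall k, 0 <= beta k /\
          'E_(P k)[fun w => (Ldev (tauY k) (Y0 k w) (Y0' k w) ^+ 2)%R]%E
            = (beta k ^+ 2)%:E) ->
       (forall k, 0 <= gamma k /\
          'E_(P k)[fun w => (Ldev (tauX k) (X0 k w) (X0' k w) ^+ 4)%R]%E
            = (gamma k ^+ 2)%:E) ->
       (forall k, 0 <= lambda k /\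
          'E_(P k)[fun w => (Ldev (tauY k) (Y0 k w) (Y0' k w) ^+ 4)%R]%E
            = (lambda k ^+ 2)%:E) ->
       (n k)%:R * alpha k @[k --> \oo] --> (0 : R) ->
       (n k)%:R * beta k @[k --> \oo] --> (0 : R) ->
       tauX k ^+ 2 * (alpha k * gamma k + gamma k ^+ 2)
         @[k --> \oo] --> (0 : R) ->
       tauY k ^+ 2 * (beta k * lambda k + lambda k ^+ 2)
         @[k --> \oo] --> (0 : R) ->
       tauXY k * (alpha k * lambda k + gamma k * beta k + gamma k * lambda k)
         @[k --> \oo] --> (0 : R) ->
       [/\ derive1 f 1 != 0 -> derive1 g 1 != 0 ->
             asymp_p P factor (fun _ _ => 1),
           bigOp P leading (fun k _ => tauXY k * alpha k * beta k) &
           lipschitz_near1 (derive1 f : R -> R) -> lipschitz_near1 (derive1 g : R -> R) ->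
             bigOp P Rn (fun k _ => tauXY k * alpha k * lambda k
                                    + tauXY k * gamma k * beta k
                                    + tauXY k * gamma k * lambda k)
             /\ littleop P Rn (fun _ _ => 1)]).
Proof.
move=> ind iid fC gC n_oo p_oo q_oo a0 Xab a'0 Yab tauX tauY tauXY gamX gamY factor leading.
(* Part (i) is an identity by the choice of the remainder; the content lies in the orders of part
   (ii). *)
pose Rn k (w : Omega k) := tauXY k * hCov2 f g (fun s => X k s w) (fun s => Y k s w)
  - factor k w * leading k w.
exists Rn; split=> [k w|]; first by rewrite addrC subrK.
move=> alpha beta gamma lambda Ha Hb Hg Hl na0 nb0 _ _ rate0.
have mX k s : measurable_fun setT (X k s) by [].
have mY k s : measurable_fun setT (Y k s) by [].
have mfactor k : measurable_fun setT (factor k).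
  apply: measurable_funM; last exact: (measurable_fun_ratio (mY k)).
  apply: measurable_funM; last exact: (measurable_fun_ratio (mX k)).
  by apply: measurable_funM; apply: measurable_fun_derive_ratio; rewrite ?sqrtr_ge0.
have mleading k : measurable_fun setT (leading k).
  by apply: measurable_funM; [exact: measurable_cst | exact: measurable_fun_sum_cov2].
have mRn k : measurable_fun setT (Rn k).
  apply: measurable_funB; last exact: measurable_funM.
  by apply: measurable_funM; [exact: measurable_cst | exact: measurable_fun_hCov2].
have pos_near (m : nat -> nat) : m k @[k --> \oo] --> \oo -> forall N : nat,
    \forall k \near \oo, (N <= m k)%N.
  by move=> m_oo N; apply: (m_oo [set j | (N <= j)%N]); exists N.
have n4 : \forall k \near \oo, (4 <= n k)%N by exact: pos_near.
(* Only eventually: p k may be 0 for small k, and then tau is 0. *)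
have tX0 : \forall k \near \oo, 0 < tauX k.
  near=> k; apply: (tauX_gt0 (ind k) _ a0 (Xab k)).
  by near: k; exact: pos_near.
have tY0 : \forall k \near \oo, 0 < tauY k.
  near=> k; apply: (tauY_gt0 (ind k) _ a'0 (Yab k)).
  by near: k; exact: pos_near.
pose G (M : R) k w :=
  good_distances M (tauX k) (alpha k) (gamma k) (fun s => X k s w) /\
  good_distances M (tauY k) (beta k) (lambda k) (fun s => Y k s w).
have G_prob M : 0 < M -> \forall k \near \oo,
    forall A, measurable A -> (forall w, A w -> ~ G M k w) -> (P k A <= (6 / M)%:E)%E.
  move=> M0; apply: nearW => k A mA; apply: (good_distances_prob (ind k) (iid k) M0 mA).
  - by have [] := Ha k. - by have [] := Hb k.
  - by have [] := Hg k. - by have [] := Hl k.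
have small (u : nat -> R) (M e : R) : (n k)%:R * u k @[k --> \oo] --> (0 : R) ->
    0 < M -> 0 < e -> \forall k \near \oo, M * ((n k)%:R * u k) ^+ 2 <= e ^+ 2.
  move=> u0 M0 e0; have s0 : 0 < e / Num.sqrt M by rewrite divr_gt0 // sqrtr_gt0.
  move/cvgrPdist_le : u0 => /(_ _ s0); apply: filterS => k; rewrite sub0r normrN.
  move=> uk; have -> : M * ((n k)%:R * u k) ^+ 2 = `|Num.sqrt M * ((n k)%:R * u k)| ^+ 2.
    by rewrite real_normK ?num_real // [RHS]exprMn sqr_sqrtr // ltW.
  rewrite ler_pXn2r ?nnegrE ?(ltW e0) // normrM.
  by rewrite ger0_norm ?sqrtr_ge0 // mulrC -ler_pdivlMr ?sqrtr_gt0.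
have GX M e : 0 < M -> 0 < e -> \forall k \near \oo, forall w, G M k w ->
    forall s u, s != u -> `|Ldev (tauX k) (X k s w) (X k u w)| <= e.
  move=> M0 e0; apply: filterS (small alpha M e na0 M0 e0) => k Me w [GXk _] s u su.
  exact: (good_Ldev_le (ltW e0) Me GXk su).
have GY M e : 0 < M -> 0 < e -> \forall k \near \oo, forall w, G M k w ->
    forall s u, s != u -> `|Ldev (tauY k) (Y k s w) (Y k u w)| <= e.
  move=> M0 e0; apply: filterS (small beta M e nb0 M0 e0) => k Me w [_ GYk] s u su.
  exact: (good_Ldev_le (ltW e0) Me GYk su).
split.
- move=> f1 g1.
  have [ef /andP[ef0 ef1] [mf mf0 [mf' mf'0 Hf]]] := derive_ratio_bounds fC f1.
  have [eg /andP[eg0 eg1] [mg mg0 [mg' mg'0 Hg']]] := derive_ratio_bounds gC g1.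
  have bnd M : 0 < M -> \forall k \near \oo, forall w, G M k w ->
      mf * mg <= `|factor k w| <= mf' * mg'.
    (* On the good event the ratios tau / gamma are near 1, so the factor is comparable to f'(1)
       g'(1). Halving the radii offsets the factor 2 in [bandwidth_concentration]. *)
    move=> M0; have hf0 : 0 < ef / 2 by rewrite divr_gt0.
    have hg0 : 0 < eg / 2 by rewrite divr_gt0.
    near=> k => w GMw.
    have n4k : (4 <= n k)%N by near: k.
    have tXk : 0 < tauX k by near: k.
    have tYk : 0 < tauY k by near: k.
    have GXk : forall w, G M k w ->
      forall s u, s != u -> `|Ldev (tauX k) (X k s w) (X k u w)| <= ef / 2 by near: k; exact: GX.
    have GYk : forall w, G M k w ->
      forall s u, s != u -> `|Ldev (tauY k) (Y k s w) (Y k u w)| <= eg / 2 by near: k; exact: GY.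
    have n1 : (1 < n k)%N by apply: leq_trans n4k.
    have hf1 : 0 < ef / 2 <= 1 / 2 by rewrite hf0 /=; lra.
    have hg1 : 0 < eg / 2 <= 1 / 2 by rewrite hg0 /=; lra.
    have [rX _] := bandwidth_concentration tXk n1 hf1 (GXk w GMw).
    have [rY _] := bandwidth_concentration tYk n1 hg1 (GYk w GMw).
    have := Hf _ (le_trans rX _); rewrite mulrC divfK // lexx => /(_ isT) /andP[f_lo f_hi].
    have := Hg' _ (le_trans rY _); rewrite mulrC divfK // lexx => /(_ isT) /andP[g_lo g_hi].
    have -> : factor k w = (derive1 f (tauX k / gamX k w) * (tauX k / gamX k w)) *
        (derive1 g (tauY k / gamY k w) * (tauY k / gamY k w)).
      by rewrite /factor; ring.
    by rewrite normrM; apply/andP; split; apply: ler_pM => //; apply: ltW.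
  split; apply: (bigOp_good G_prob) => //.
  + move=> M M0; exists (mf' * mg'); first exact: mulr_gt0.
    by apply: filterS (bnd M M0) => k Hk w /Hk /andP[_]; rewrite normr1 mulr1.
  + move=> M M0; exists (mf * mg)^-1; first by rewrite invr_gt0 mulr_gt0.
    apply: filterS (bnd M M0) => k Hk w /Hk /andP[+ _]; rewrite normr1.
    by rewrite ler_pdivlMl ?mulr_gt0 // mulr1.
- apply: (bigOp_good G_prob) => // M M0.
  (* 4 M is (2 sqrt M)^2: one factor 2 sqrt M for each of the two root mean squares. *)
  exists (4 * M); first exact: mulr_gt0.
  near=> k => w [GXw GYw].
  have tXk : 0 < tauX k by near: k.
  have tYk : 0 < tauY k by near: k.
  have [al0 _] := Ha k; have [be0 _] := Hb k.
  have [X2 _] := good_Lpow_le (ltW M0) GXw; have [Y2 _] := good_Lpow_le (ltW M0) GYw.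
  have sM : 0 <= 2 * Num.sqrt M by rewrite mulr_ge0 ?sqrtr_ge0.
  apply: le_trans (leading_bound tXk tYk _ _ X2 Y2) _; rewrite ?mulr_ge0 //.
  have tXY : 0 <= tauXY k by rewrite mulr_ge0 // ltW.
  have rate_ge0 : 0 <= tauXY k * alpha k * beta k by apply: mulr_ge0 => //; apply: mulr_ge0.
  rewrite (ger0_norm rate_ge0) le_eqVlt; apply/orP; left; apply/eqP.
  by rewrite -[X in 4 * X](sqr_sqrtr (ltW M0)) /tauXY; ring.
- move=> fL gL.
  have RnO : bigOp P Rn (fun k _ => tauXY k * alpha k * lambda k
      + tauXY k * gamma k * beta k + tauXY k * gamma k * lambda k).
    apply: (bigOp_good G_prob) => // M M0.
    have [ef ef01 [Kf Kf0 Hf]] := kernel_expansion fC fL.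
    have [eg eg01 [Kg Kg0 Hg']] := kernel_expansion gC gL.
    have [ef0 eg0] : 0 < ef /\ 0 < eg by case/andP: ef01; case/andP: eg01.
    (* One constant for both kernels; the added 1 makes it positive, as the witness in [bigOp] must
       be. *)
    pose K := Kf + Kg + 1.
    have [KfK KgK] : Kf <= K /\ Kg <= K by rewrite /K; split; lra.
    have K0 : 0 < K by rewrite /K; lra.
    exists (K ^+ 2 * (4 * M)); first by rewrite !mulr_gt0 // exprn_gt0.
    near=> k => w GMw.
    have n4k : (4 <= n k)%N by near: k.
    have tXk : 0 < tauX k by near: k.
    have tYk : 0 < tauY k by near: k.
    have GXk : forall w, G M k w ->
      forall s u, s != u -> `|Ldev (tauX k) (X k s w) (X k u w)| <= ef by near: k; exact: GX.
    have GYk : forall w, G M k w ->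
      forall s u, s != u -> `|Ldev (tauY k) (Y k s w) (Y k u w)| <= eg by near: k; exact: GY.
    have n1 : (1 < n k)%N by apply: leq_trans n4k.
    have [cK [c0 cP]] := Hf _ _ (fun s => X k s w) _ tXk n1 (GXk w GMw).
    have [dK [d0 dP]] := Hg' _ _ (fun s => Y k s w) _ tYk n1 (GYk w GMw).
    have [al0 _] := Ha k; have [be0 _] := Hb k; have [ga0 _] := Hg k; have [la0 _] := Hl k.
    have [GXw GYw] := GMw.
    have [X2 X4] := good_Lpow_le (ltW M0) GXw; have [Y2 Y4] := good_Lpow_le (ltW M0) GYw.
    have sM : 0 <= 2 * Num.sqrt M by rewrite mulr_ge0 ?sqrtr_ge0.
    have -> : Rn k w = tauX k * tauY k * hCov2 f g (fun s => X k s w) (fun s => Y k s w)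
        - derive1 f (tauX k / gamX k w) * (tauX k / gamX k w) *
          (derive1 g (tauY k / gamY k w) * (tauY k / gamY k w)) *
          ((tauX k * tauY k)^-1 * sum_cov2 (fun s => X k s w) (fun s => Y k s w)).
      by rewrite /Rn /factor /leading /tauXY; ring.
    have HR := remainder_bound (c0 := c0) (d0 := d0) n4k tXk tYk (mulr_ge0 sM al0) (mulr_ge0 sM be0)
      (mulr_ge0 sM ga0) (mulr_ge0 sM la0) X2 Y2 X4 Y4 (ltW K0) (le_trans cK KfK) (le_trans dK KgK).
    apply: le_trans (HR _ _ _ _) _.
    + by move=> s u su; apply: le_trans (cP s u su) _; rewrite ler_wpM2r // sqr_ge0.
    + by move=> s u su; apply: le_trans (dP s u su) _; rewrite ler_wpM2r // sqr_ge0.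
    have tXY : 0 <= tauXY k by rewrite mulr_ge0 // ltW.
    rewrite ger0_norm; last by rewrite !addr_ge0 //; apply: mulr_ge0 => //; apply: mulr_ge0.
    rewrite le_eqVlt; apply/orP; left; apply/eqP; rewrite -/(tauXY k).
    by rewrite -[X in 4 * X](sqr_sqrtr (ltW M0)); ring.
  split=> //; apply: (bigOp_littleop mRn RnO).
  suff -> : (fun k => tauXY k * alpha k * lambda k + tauXY k * gamma k * beta k
      + tauXY k * gamma k * lambda k) = (fun k => tauXY k * (alpha k * lambda k
      + gamma k * beta k + gamma k * lambda k)) by [].
  by apply/funext => k; ring.
Unshelve. all: by end_near. Qed.
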